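(* Let $0<a\le 2$ and let $d>d_a$, where $d_a=3$ if $a=1$ and $d_a=2$ if $a\neq 1$. Then there is no constant $C<\infty$ such that \[ \|e^{itD^a}f\|_{L^2_tL^\infty_x(\mathbb{R}\times\mathbb{R}^d)}\le C\,\|f\|_{H^{\frac{d-a}{2}}(\mathbb{R}^d)} \] holds for all Schwartz functions $f$ on $\mathbb{R}^d$.
   Context: $D=\sqrt{-\Delta}$ on $\mathbb{R}^d$, and $e^{itD^a}=\mathcal{F}^{-1}e^{it|\xi|^a}\mathcal{F}$ is the Fourier multiplier with symbol $e^{it|\xi|^a}$ (Fourier transform $\hat f(\xi)=\int e^{-ix\cdot\xi}f(x)\,dx$). $H^s$ denotes the inhomogeneous $L^2$-Sobolev space with norm $\|(1+|\xi|^2)^{s/2}\hat f\|_{L^2}$. $\|u\|_{L^2_tL^\infty_x}=\big\|\|u(t,\cdot)\|_{L^\infty(\mathbb{R}^d)}\big\|_{L^2_t(\mathbb{R})}$. *)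

(* Defs.v *)
From HB Require Import structures.
From mathcomp Require Import all_boot all_order all_algebra.
From mathcomp Require Import all_classical all_reals all_analysis.
From mathcomp Require Import complex.

Set Implicit Arguments.
Unset Strict Implicit.
Unset Printing Implicit Defensive.

Import Order.TTheory GRing.Theory Num.Theory.
Local Open Scope ring_scope.
Local Open Scope classical_set_scope.

Section Defs.
Variable R : realType.

Definition vdot (n : nat) (x y : 'rV[R]_n) : R := \sum_(i < n) x 0 i * y 0 i.
Definition vnorm (n : nat) (x : 'rV[R]_n) : R := Num.sqrt (\sum_(i < n) x 0 i ^+ 2).

(* Lebesgue integral over R^n, computed as iterated one-dimensional
   Lebesgue integrals (Fubini/Tonelli): extended-real version for
   nonnegative integrands, real version for absolutely integrable ones. *)
Fixpoint Eint (n : nat) : ('rV[R]_n -> \bar R) -> \bar R :=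
  match n return ('rV[R]_n -> \bar R) -> \bar R with
  | 0 => fun F => F 0
  | n'.+1 => fun F =>
      (\int[@lebesgue_measure R]_(s in [set: R])
          Eint (fun y : 'rV[R]_n' => F (row_mx (const_mx s : 'rV[R]_1) y)))%E
  end.

Fixpoint Rint (n : nat) : ('rV[R]_n -> R) -> R :=
  match n return ('rV[R]_n -> R) -> R with
  | 0 => fun F => F 0
  | n'.+1 => fun F =>
      Rintegral (@lebesgue_measure R) [set: R]
        (fun s => Rint (fun y : 'rV[R]_n' => F (row_mx (const_mx s : 'rV[R]_1) y)))
  end.

Definition Cint (n : nat) (F : 'rV[R]_n -> R[i]) : R[i] :=
  Complex (Rint (fun x => complex.Re (F x))) (Rint (fun x => complex.Im (F x))).

Definition cabs (z : R[i]) : R := Num.sqrt (complex.Re z ^+ 2 + complex.Im z ^+ 2).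

Definition expi (theta : R) : R[i] := Complex (cos theta) (sin theta).

Definition iterD (n : nat) (bs : seq 'I_n) (g : 'rV[R]_n -> R) : 'rV[R]_n -> R :=
  foldr (fun i h => fun x => derive h x (delta_mx 0 i)) g bs.

Definition schwartzR (n : nat) (g : 'rV[R]_n -> R) : Prop :=
  (forall (bs : seq 'I_n) (i : 'I_n) (x : 'rV[R]_n),
      derivable (iterD bs g) x (delta_mx 0 i)) /\
  (forall (k : nat) (bs : seq 'I_n), exists M : R, forall x : 'rV[R]_n,
      (1 + vnorm x ^+ 2) ^+ k * `|iterD bs g x| <= M).

Definition schwartz (n : nat) (f : 'rV[R]_n -> R[i]) : Prop :=
  schwartzR (fun x => complex.Re (f x)) /\ schwartzR (fun x => complex.Im (f x)).

Definition fourier (n : nat) (f : 'rV[R]_n -> R[i]) (xi : 'rV[R]_n) : R[i] :=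
  Cint (fun x => expi (- vdot x xi) * f x).

Definition prop_op (a : R) (n : nat) (t : R) (f : 'rV[R]_n -> R[i])
  (x : 'rV[R]_n) : R[i] :=
  Complex (((2 * pi) ^+ n)^-1) 0 *
  Cint (fun xi => expi (vdot x xi + t * (vnorm xi `^ a)) * fourier f xi).

Definition Linf_x (n : nat) (u : 'rV[R]_n -> R[i]) : \bar R :=
  ereal_sup [set (cabs (u x))%:E | x in [set: 'rV[R]_n]].

Definition L2tLinfx (a : R) (n : nat) (f : 'rV[R]_n -> R[i]) : \bar R :=
  Lnorm (@lebesgue_measure R) 2%:E (fun t => Linf_x (prop_op a t f)).

Definition Hnorm (s : R) (n : nat) (f : 'rV[R]_n -> R[i]) : \bar R :=
  poweR (Eint (fun xi : 'rV[R]_n =>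
    (((1 + vnorm xi ^+ 2) `^ (s / 2) * cabs (fourier f xi)) ^+ 2)%:E)) 2^-1.

Definition d_a (a : R) : nat := if a == 1 then 3%N else 2%N.

End Defs.

(* Main.v *)
Require Import Defs.
From HB Require Import structures.
From mathcomp Require Import all_boot all_order all_algebra.
From mathcomp Require Import all_classical all_reals all_analysis.
From mathcomp Require Import complex.
From mathcomp Require Import measurable_realfun metric_structure lebesgue_integral_under.
From mathcomp Require Import ring lra zify.
Import Order.TTheory GRing.Theory Num.Theory.
Import numFieldNormedType.Exports.
Local Open Scope ring_scope.

(** By duality and an averaging argument, the estimate fails already along random
    space-time paths.  Fix frequencies N_0 << N_1 << ... << N_(K-1) and cut the time
    interval [0, T] into 36^k blocks at level k, of length ~ N_k^(-a).  Take the path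
    y(t) = sum_k +-1/(2 d N_k), with an independent sign for every level k and every
    block at level k.  Given the signs w, let f_w be the sum over k, over the lattice
    points l of the cube (N_k, 2 N_k]^d and over the level-k blocks I, of
    N_k^(-d) w(k,I) times a unit-scale Gaussian packet of frequency l whose phase is
    chosen so that e^(itD^a) f_w is aligned with the path at levels < k during I.

    On average over w, a packet of block I contributes nothing to Re u(t, y(t)) for t
    outside I, since flipping w(k,I) changes its sign and nothing else; inside I the
    correlation of w(k,I) with the displacement +-1/(2 d N_k) yields a gain
    >= N_k^(-d)/16.  Each level thus contributes 1/16, so the average of
    ||u||^2 in L^2_t L^oo_x is at least T (K/16)^2.  By orthogonality of the signs, the
    average of ||f_w||^2 in H^((d-a)/2) is at most a constant times T K.  Letting
    K tend to infinity contradicts the estimate.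

    Replacing T by a small number moves all frequencies to infinity, so that a packet
    of frequency l moves on [0, T] like a plane wave: this uses a <= 2, through
    ||l+h|^a - |l|^a| <= ||l+h|^2 - |l|^2|^(a/2). *)

Set Implicit Arguments.
Unset Strict Implicit.
Unset Printing Implicit Defensive.

(** * Iterated integrals *)

Section IteratedIntegral.
Local Open Scope classical_set_scope.
Context {R : realType}.
Local Notation mu := (@lebesgue_measure R).
Local Notation Rint := Defs.Rint.

Definition consv n (s : R) (y : 'rV[R]_n) : 'rV[R]_n.+1 :=
  row_mx (const_mx s : 'rV_1) y.

Lemma consv0 n s (y : 'rV[R]_n) : consv s y 0 ord0 = s.
Proof.
have -> : ord0 = lshift n (ord0 : 'I_1) by exact: val_inj.
by rewrite /consv (@row_mxEl _ 1 1 n) mxE.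
Qed.

Lemma consvS n s (y : 'rV[R]_n) i : consv s y 0 (lift ord0 i) = y 0 i.
Proof.
have -> : lift ord0 i = rshift 1 i by exact: val_inj.
by rewrite /consv (@row_mxEr _ 1 1 n).
Qed.

Lemma RintS n (F : 'rV[R]_n.+1 -> R) :
  Rint F = \int[mu]_s Rint (fun y => F (consv s y)).
Proof. by []. Qed.

Lemma EintS n (F : 'rV[R]_n.+1 -> \bar R) :
  Eint F = (\int[mu]_s Eint (fun y => F (consv s y)))%E.
Proof. by []. Qed.

(* Continuity is phrased through coordinatewise convergent sequences, the form in which
   dominated convergence yields the continuity of the inner integrals. *)
Definition seqcont n (F : 'rV[R]_n -> R) := forall (xs : nat -> 'rV[R]_n) (x : 'rV[R]_n),
  (forall i, xs m 0 i @[m --> \oo] --> x 0 i) -> F (xs m) @[m --> \oo] --> F x.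

(* A fixed envelope: wide enough to dominate, up to constants, all the translated
   Gaussians of variance at most 2 that occur below. *)
Definition env n (x : 'rV[R]_n) : R := expR (- (\sum_(i < n) x 0 i ^+ 2) / 8).

Definition env1 (s : R) : R := expR (- s ^+ 2 / 8).

Lemma env_cons n s (y : 'rV[R]_n) : env (consv s y) = env1 s * env y.
Proof.
rewrite /env /env1 big_ord_recl consv0 -expRD; congr expR.
by under eq_bigr do rewrite consvS; field.
Qed.

(** The integrand is the normal density of mean [m] and variance [s ^+ 2] divided by its peak value,
    and the density has integral 1. *)
Lemma integral_gauss1 (m s : R) : s != 0 ->
  mu.-integrable [set: R] (fun x => (expR (- (x - m) ^+ 2 / (s ^+ 2 *+ 2)))%:E) /\
  \int[mu]_x expR (- (x - m) ^+ 2 / (s ^+ 2 *+ 2)) = Num.sqrt (s ^+ 2 * pi *+ 2).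
Proof.
move=> s0.
have p0 := normal_peak_gt0 s0.
have E : (fun x => (expR (- (x - m) ^+ 2 / (s ^+ 2 *+ 2)))%:E) =
  (fun x => ((normal_peak s)^-1%:E * (normal_pdf m s x)%:E))%E.
  apply/funext => x; rewrite normal_pdfE// -EFinM /normal_fun; congr EFin.
  by rewrite mulrA mulVf ?mul1r// gt_eqF.
have := integrable_normal_pdf m s => ip.
split; first by rewrite E; exact: integrableZl.
rewrite /Rintegral E integralZl// integral_normal_pdf mule1 /=.
by rewrite /normal_peak invrK.
Qed.

Lemma env1_integrable : mu.-integrable [set: R] (EFin \o env1).
Proof.
have := (@integral_gauss1 0 2 _).1; rewrite pnatr_eq0 => /(_ isT).
rewrite (_ : (fun x => _) = EFin \o env1)//.
apply/funext => x /=; congr EFin; rewrite /env1 subr0; congr expR; congr (_ / _).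
by ring.
Qed.

Definition G1 := \int[mu]_s env1 s.

Lemma Rintegral_cvg (f_ : nat -> R -> R) (f : R -> R) (M : R) :
  (forall m, continuous (f_ m)) -> continuous f ->
  (forall m s, `|f_ m s| <= M * env1 s) ->
  (forall s, f_ m s @[m --> \oo] --> f s) ->
  \int[mu]_s f_ m s @[m --> \oo] --> \int[mu]_s f s.
Proof.
move=> cf_ cf b c.
have mf (g : R -> R) : continuous g -> measurable_fun setT (fun s : R => (g s)%:E).
  by move=> ?; apply/measurable_EFinP; exact: continuous_measurable_fun.
have cE s : (f_ m s)%:E @[m --> \oo] --> (f s)%:E.
  by apply/fine_cvgP; split; [exact: nearW|exact: c].
have [i _ h] := @dominated_convergence _ _ R mu setT measurableT
  (fun m s => (f_ m s)%:E) (fun s => (f s)%:E) (fun s => (M%:E * (env1 s)%:E)%E)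
  (fun m => mf _ (cf_ m)) (mf _ cf)
  (aeW mu (fun s (_ : [set: R] s) => cE s))
  (integrableZl measurableT M env1_integrable)
  (aeW mu (fun s m (_ : [set: R] s) => b m s)).
apply: fine_cvg; rewrite fineK//.
exact: integrable_fin_num.
Qed.

Lemma cont_dom_integrable (f : R -> R) (M : R) : continuous f ->
  (forall s, `|f s| <= M * env1 s) -> mu.-integrable [set: R] (EFin \o f).
Proof.
move=> cf b; apply: (le_integrable measurableT _ _
  (integrableZl measurableT M env1_integrable)).
  by apply/measurable_EFinP; exact: continuous_measurable_fun.
move=> s _ /=; rewrite lee_fin (le_trans (b s))// ler_norm//.
Qed.

Lemma seqcont_consv n s (F : 'rV[R]_n.+1 -> R) :
  seqcont F -> seqcont (fun y => F (consv s y)).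
Proof.
move=> sF xs x h; apply: sF => i; case: (unliftP ord0 i) => [j ->|->].
  by under eq_fun do rewrite consvS; rewrite consvS; exact: h.
by under eq_fun do rewrite consv0; rewrite consv0; exact: cvg_cst.
Qed.

Lemma dom_consv n s (F : 'rV[R]_n.+1 -> R) M : (forall x, `|F x| <= M * env x) ->
  forall y, `|F (consv s y)| <= (M * env1 s) * env y.
Proof. by move=> h y; rewrite -mulrA -env_cons. Qed.

Lemma env1_le1 s : env1 s <= 1.
Proof. by rewrite -expR0 ler_expR mulNr oppr_le0 divr_ge0 ?sqr_ge0. Qed.

(** One induction proves the bound and the convergence together: in the next dimension the inner
    integral must be dominated, by the bound, and continuous in the outer variable, by the
    convergence. *)
Lemma Rint_bound_cvg n :
  (forall (F : 'rV[R]_n -> R) M, seqcont F -> (forall x, `|F x| <= M * env x) ->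
    `|Rint F| <= M * G1 ^+ n) /\
  (forall (F_ : nat -> 'rV[R]_n -> R) F M, (forall m, seqcont (F_ m)) -> seqcont F ->
    (forall m x, `|F_ m x| <= M * env x) ->
    (forall x, F_ m x @[m --> \oo] --> F x) ->
    Rint (F_ m) @[m --> \oo] --> Rint F).
Proof.
elim: n => [|n [IHb IHc]].
  split=> [F M _ /(_ 0)|F_ F M _ _ _ /(_ 0)//].
  by rewrite /env big_ord0 oppr0 mul0r expR0 expr0.
have inner F M : seqcont F -> (forall x, `|F x| <= M * env x) ->
    continuous (fun s => Rint (fun y => F (@consv n s y))) /\
    forall s, `|Rint (fun y => F (@consv n s y))| <= (M * G1 ^+ n) * env1 s.
  move=> sF bF; split=> [s|s]; last first.
    rewrite mulrAC; apply: IHb; [exact: seqcont_consv|exact: dom_consv].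
  apply/(@cvg_nbhsP _ R^o) => u us.
  (* As [env1 (u m) <= 1], the absolute value of [M] gives a majorant independent of [m]. *)
  apply: (IHc (fun m y => F (consv (u m) y)) _ (`|M|)).
  - by move=> m; exact: seqcont_consv.
  - exact: seqcont_consv.
  - move=> m y; apply: (le_trans (dom_consv _ bF y)).
    rewrite ler_pM2r ?expR_gt0//; apply: (le_trans (ler_norm _)).
    by rewrite normrM ler_piMr// ger0_norm ?expR_ge0// env1_le1.
  - move=> y; apply: sF => i.
    case: (unliftP ord0 i) => [j ->|->].
      by under eq_fun do rewrite consvS; rewrite consvS; exact: cvg_cst.
    by under eq_fun do rewrite consv0; rewrite consv0.
split=> [F M sF bF|F_ F M sF_ sF bF cF].
  rewrite RintS; have [c b] := inner _ _ sF bF.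
  have i := cont_dom_integrable c b.
  apply: (le_trans (le_normr_Rintegral _ i)) => //.
  rewrite exprSr mulrA -RintegralZl//; last exact: env1_integrable.
  apply: le_Rintegral => //.
    exact: (integrable_norm i).
  exact: (integrableZl measurableT _ env1_integrable).
have bF' x : `|F x| <= M * env x.
  by apply: (@cvgr_to_le _ _ _ _ _ _ _ (cvg_norm (cF x))); apply: nearW => m.
have [c b] := inner _ _ sF bF'.
apply: (@Rintegral_cvg _ _ (M * G1 ^+ n)) => //.
- by move=> m; have [] := inner _ _ (sF_ m) (bF m).
- by move=> m; have [] := inner _ _ (sF_ m) (bF m).
- move=> s; apply: (IHc _ _ (M * env1 s)) => [m||m|y].
  + exact: seqcont_consv.
  + exact: seqcont_consv.
  + exact: dom_consv.
  + exact: cF.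
Qed.

(** On this class all the iterated integrals converge absolutely, so that [Rint] is linear and
    monotone; it is stable under freezing the first coordinate. *)
Definition nice n (F : 'rV[R]_n -> R) :=
  seqcont F /\ exists M, forall x, `|F x| <= M * env x.

Lemma nice_consv n s (F : 'rV[R]_n.+1 -> R) : nice F -> nice (fun y => F (consv s y)).
Proof.
move=> [sF [M bF]]; split; first exact: seqcont_consv.
by exists (M * env1 s); exact: dom_consv.
Qed.

Lemma nice_inner n (F : 'rV[R]_n.+1 -> R) : nice F ->
  continuous (fun s => Rint (fun y => F (consv s y))) /\
  mu.-integrable [set: R] (EFin \o (fun s => Rint (fun y => F (consv s y)))).
Proof.
move=> [sF [M bF]].
have c : continuous (fun s => Rint (fun y => F (consv s y))).
  move=> s; apply/(@cvg_nbhsP _ R^o) => u us.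
  apply: ((Rint_bound_cvg n).2 (fun m y => F (consv (u m) y)) _ (`|M|)).
  - by move=> m; exact: seqcont_consv.
  - exact: seqcont_consv.
  - move=> m y; apply: (le_trans (dom_consv _ bF y)).
    rewrite ler_pM2r ?expR_gt0//; apply: (le_trans (ler_norm _)).
    by rewrite normrM ler_piMr// ger0_norm ?expR_ge0// env1_le1.
  - move=> y; apply: sF => i.
    case: (unliftP ord0 i) => [j ->|->].
      by under eq_fun do rewrite consvS; rewrite consvS; exact: cvg_cst.
    by under eq_fun do rewrite consv0; rewrite consv0.
split => //; apply: (@cont_dom_integrable _ (M * G1 ^+ n) c) => s.
rewrite mulrAC; apply: (Rint_bound_cvg n).1; first exact: seqcont_consv.
exact: dom_consv.
Qed.

Lemma nice_le n (F G : 'rV[R]_n -> R) : seqcont F -> nice G ->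
  (forall x, `|F x| <= `|G x|) -> nice F.
Proof.
move=> sF [_ [M bG]] FG; split => //; exists M => x.
exact: le_trans (FG x) (bG x).
Qed.

Lemma seqcont_cst n c : seqcont (fun=> c : R) (n := n).
Proof. by move=> xs x _; exact: cvg_cst. Qed.

Lemma seqcont_coord n i : seqcont (fun x : 'rV[R]_n => x 0 i).
Proof. by move=> xs x h; exact: h. Qed.

Lemma seqcontD n (F G : 'rV[R]_n -> R) : seqcont F -> seqcont G ->
  seqcont (fun x => F x + G x).
Proof. by move=> hF hG xs x h; apply: cvgD; [exact: hF|exact: hG]. Qed.

Lemma seqcontM n (F G : 'rV[R]_n -> R) : seqcont F -> seqcont G ->
  seqcont (fun x => F x * G x).
Proof. by move=> hF hG xs x h; apply: cvgM; [exact: hF|exact: hG]. Qed.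

Lemma seqcont_comp n (g : R -> R) (F : 'rV[R]_n -> R) : continuous g -> seqcont F ->
  seqcont (fun x => g (F x)).
Proof. by move=> cg hF xs x h; apply: continuous_cvg; [exact: cg|exact: hF]. Qed.

Lemma seqcont_sum n (I : Type) (r : seq I) (F : I -> 'rV[R]_n -> R) :
  (forall i, seqcont (F i)) -> seqcont (fun x => \sum_(i <- r) F i x).
Proof.
move=> h; elim: r => [|i r IH].
  by under [X in seqcont X]eq_fun do rewrite big_nil; exact: seqcont_cst.
by under [X in seqcont X]eq_fun do rewrite big_cons; exact: seqcontD.
Qed.

Lemma niceD n (F G : 'rV[R]_n -> R) : nice F -> nice G -> nice (fun x => F x + G x).
Proof.
move=> [sF [M bF]] [sG [N bG]]; split; first exact: seqcontD.
by exists (M + N) => x; rewrite mulrDl (le_trans (ler_normD _ _))// lerD.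
Qed.

Lemma niceZ n c (F : 'rV[R]_n -> R) : nice F -> nice (fun x => c * F x).
Proof.
move=> [sF [M bF]]; split; first by apply: seqcontM => //; exact: seqcont_cst.
by exists (`|c| * M) => x; rewrite normrM -mulrA ler_wpM2l.
Qed.

Lemma nice0 n : nice (fun _ : 'rV[R]_n => 0).
Proof. by split; [exact: seqcont_cst|exists 0 => x; rewrite normr0 mul0r]. Qed.

Lemma nice_sum n (I : Type) (r : seq I) (F : I -> 'rV[R]_n -> R) :
  (forall i, nice (F i)) -> nice (fun x => \sum_(i <- r) F i x).
Proof.
move=> h; elim: r => [|i r IH].
  by under [X in nice X]eq_fun do rewrite big_nil; exact: nice0.
by under [X in nice X]eq_fun do rewrite big_cons; exact: niceD.
Qed.

Lemma eq_Rint n (F G : 'rV[R]_n -> R) : F =1 G -> Rint F = Rint G.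
Proof. by move=> /funext ->. Qed.

Lemma RintD n (F G : 'rV[R]_n -> R) : nice F -> nice G ->
  Rint (fun x => F x + G x) = Rint F + Rint G.
Proof.
elim: n F G => // n IH F G nF nG.
rewrite !RintS -RintegralD//; [|exact: (nice_inner nF).2|exact: (nice_inner nG).2].
by apply: eq_Rintegral => s _; rewrite -IH//; exact: nice_consv.
Qed.

Lemma RintZ n c (F : 'rV[R]_n -> R) : nice F ->
  Rint (fun x => c * F x) = c * Rint F.
Proof.
elim: n F => // n IH F nF.
rewrite !RintS -RintegralZl//; last exact: (nice_inner nF).2.
by apply: eq_Rintegral => s _; rewrite -IH//; exact: nice_consv.
Qed.

Lemma Rint_zero n : Rint (fun _ : 'rV[R]_n => 0) = 0.
Proof. by have := RintZ 0 (nice0 n); under eq_Rint do rewrite mul0r; rewrite mul0r. Qed.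

Lemma Rint_sum n (I : Type) (r : seq I) (F : I -> 'rV[R]_n -> R) :
  (forall i, nice (F i)) ->
  Rint (fun x => \sum_(i <- r) F i x) = \sum_(i <- r) Rint (F i).
Proof.
move=> h; elim: r => [|i r IH].
  by under eq_Rint do rewrite big_nil; rewrite Rint_zero big_nil.
under eq_Rint do rewrite big_cons.
by rewrite RintD// ?IH ?big_cons//; exact: nice_sum.
Qed.

Lemma Rint_le n (F G : 'rV[R]_n -> R) : nice F -> nice G ->
  (forall x, F x <= G x) -> Rint F <= Rint G.
Proof.
elim: n F G => [F G _ _|n IH F G nF nG FG]; first exact.
rewrite !RintS; apply: le_Rintegral => //.
- exact: (nice_inner nF).2.
- exact: (nice_inner nG).2.
- by move=> s _; apply: IH => //; exact: nice_consv.
Qed.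

Lemma Rint_ge0 n (F : 'rV[R]_n -> R) : nice F -> (forall x, 0 <= F x) -> 0 <= Rint F.
Proof. by move=> nF F0; rewrite -(Rint_zero n); apply: Rint_le => //; exact: nice0. Qed.

Lemma Rint_abs_le n (F G : 'rV[R]_n -> R) : nice F -> nice G ->
  (forall x, `|F x| <= G x) -> `|Rint F| <= Rint G.
Proof.
move=> nF nG FG; rewrite ler_norml; apply/andP; split.
  rewrite -mulN1r -RintZ//; apply: Rint_le => //; first exact: niceZ.
  by move=> x; rewrite mulN1r; have := FG x; rewrite ler_norml => /andP[].
by apply: Rint_le => // x; exact: le_trans (ler_norm _) (FG x).
Qed.

(** The Sobolev norm is defined through [Eint]; this allows it to be computed with [Rint]. *)
Lemma Eint_EFin n (F : 'rV[R]_n -> R) : nice F ->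
  Eint (fun x => (F x)%:E) = (Rint F)%:E.
Proof.
elim: n F => // n IH F nF; rewrite EintS RintS.
transitivity (\int[mu]_s (Rint (fun y => F (consv s y)))%:E)%E.
  by apply: eq_integral => s _; rewrite IH//; exact: nice_consv.
by rewrite /Rintegral fineK//; apply: integrable_fin_num => //; exact: (nice_inner nF).2.
Qed.

End IteratedIntegral.

(** * Gaussian integrals *)

Section GaussianFourier.
Local Open Scope classical_set_scope.
Context {R : realType}.
Local Notation mu := (@lebesgue_measure R).
Local Notation Rint := Defs.Rint.

Lemma env1_nat_cvg0 : env1 (n%:R : R) @[n --> \oo] --> (0 : R).
Proof.
apply: (@squeeze_cvgr _ _ _ _ (fun=> 0) (fun n => 8 * (n.+1%:R)^-1)).
- apply: nearW => n; rewrite expR_ge0/= /env1 mulNr expRN.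
  rewrite -[leRHS]invrK lef_pV2 ?posrE ?expR_gt0 ?invr_gt0 ?mulr_gt0 ?invr_gt0//.
  apply: le_trans (expR_ge1Dx _); rewrite invfM invrK -natr1.
  rewrite mulrC ler_pdivrMr// mulrDl mul1r divfK//; have := ler0n R n; nra.
- exact: cvg_cst.
- by rewrite -[X in _ --> X](mulr0 8); apply: cvgMr; exact: cvg_harmonic.
Qed.

(** The fundamental theorem of calculus on [[-n, n]] leaves boundary values of [F], which vanish in
    the limit; dominated convergence recovers the integral over the line. *)
Lemma integral_derivative0 (F f : R -> R) (M : R) :
  (forall x : R, is_derive x (1 : R) F (f x)) -> continuous f ->
  (forall s, `|F s| <= M * env1 s) -> (forall s, `|f s| <= M * env1 s) ->
  \int[mu]_s f s = 0.
Proof.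
move=> dF cf bF bf.
have cF : continuous F.
  by move=> x; apply/differentiable_continuous/derivable1_diffP.
have intf := cont_dom_integrable cf bf.
pose f_ (n : nat) := (EFin \o f) \_ `[- (n%:R : R), n%:R].
have mf : measurable_fun [set: R] (fun s : R => (f s)%:E).
  by apply/measurable_EFinP; exact: continuous_measurable_fun.
have mf_ n : measurable_fun [set: R] (f_ n).
  by apply/(measurable_restrictT (EFin \o f)) => //; exact: measurable_funTS.
have c s : f_ n s @[n --> \oo] --> (f s)%:E.
  apply: (cvg_near_cst); near=> n; rewrite /f_ patchE ifT// inE/= in_itv/=.
  rewrite -ler_norml; near: n; exact: nbhs_infty_ger.
have b s n : (`|f_ n s| <= M%:E * (env1 s)%:E)%E.
  rewrite /f_ patchE; case: ifP => _; first by rewrite lee_fin bf.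
  by rewrite abse0 lee_fin (le_trans _ (bf s)).
have [_ _ h] := @dominated_convergence _ _ R mu setT measurableT f_
  (fun s => (f s)%:E) (fun s => (M%:E * (env1 s)%:E)%E) mf_ mf
  (aeW mu (fun s (_ : [set: R] s) => c s))
  (integrableZl measurableT M env1_integrable)
  (aeW mu (fun s n (_ : [set: R] s) => b s n)).
(* The index [n.+1] keeps the interval nondegenerate. *)
have e n : (\int[mu]_x f_ n.+1 x = (F n.+1%:R - F (- n.+1%:R))%:E)%E.
  rewrite -integral_mkcond EFinB; apply: continuous_FTC2 => //.
  - by rewrite gtrN// ltr0n.
  - exact: continuous_subspaceT.
  - split=> [x _| |]; first by [].
      by apply: cvg_at_right_filter; exact: cF.
    by apply: cvg_at_left_filter; exact: cF.
  - by move=> x _; rewrite derive1E; have [_ ->] := dF x.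
have h' : (F n.+1%:R - F (- n.+1%:R)) @[n --> \oo] --> \int[mu]_s f s.
  have h2 : (fine \o (fun n => \int[mu]_x f_ n x)%E) n @[n --> \oo] --> \int[mu]_s f s.
    by apply: fine_cvg; rewrite fineK//; exact: integrable_fin_num.
  rewrite -(cvg_shiftS (fine \o _)) in h2.
  by under eq_fun do rewrite -[F _ - F _]/(fine (F _ - F _)%:E) -e.
apply: (cvg_unique _ h') => //.
apply: norm_cvg0.
apply: (@squeeze_cvgr _ _ _ _ (fun=> 0) (fun n => (M + M) * env1 n.+1%:R)).
- apply: nearW => n; rewrite normr_ge0/= mulrDl (le_trans (ler_normB _ _))// lerD//.
  by rewrite (le_trans (bF _))// /env1 sqrrN.
- exact: cvg_cst.
- rewrite -[X in _ --> X](mulr0 (M + M)); apply: cvgMr.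
  by rewrite (cvg_shiftS (fun n => env1 (n%:R : R))); exact: env1_nat_cvg0.
Unshelve. all: by end_near. Qed.

Lemma abs_expR_half (s : R) : (1 + `|s|) * expR (- s ^+ 2 / 2) <= 3 * env1 s.
Proof.
have -> : expR (- s ^+ 2 / 2) = expR (- s ^+ 2 / 8) * expR (- (3 * s ^+ 2 / 8)).
  by rewrite -expRD; congr expR; field.
rewrite mulrCA mulrC /env1 ler_wpM2r ?expR_ge0// expRN.
rewrite ler_pdivrMr ?expR_gt0//.
apply: (@le_trans _ _ (3 * (1 + 3 * s ^+ 2 / 8))); last by rewrite ler_pM2l// expR_ge1Dx.
have := normr_ge0 s; rewrite -(real_normK (num_real s)); nra.
Qed.

Lemma is_derive_sqr (s : R) : is_derive s (1 : R) (fun s => s ^+ 2) (2 * s).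
Proof.
rewrite (_ : (fun s => _) = (fun s => s * s)); last by apply/funext => ?; rewrite expr2.
apply: is_derive_eq (is_deriveM (is_derive_id s 1) (is_derive_id s 1)) _.
by rewrite /GRing.scale/=; ring.
Qed.

(* As a function of [xi] the integral solves the equation phi' = - xi * phi. *)
Lemma gauss_cos1 (xi c : R) :
  \int[mu]_s (cos (s * xi + c) * expR (- s ^+ 2 / 2)) =
  Num.sqrt (2 * pi) * expR (- xi ^+ 2 / 2) * cos c.
Proof.
pose phi (x : R) := \int[mu]_s (cos (s * x + c) * expR (- s ^+ 2 / 2)).
have bcos (x s : R) : `|cos (s * x + c) * expR (- s ^+ 2 / 2)| <= 3 * env1 s.
  rewrite normrM (ger0_norm (expR_ge0 _)) (le_trans _ (abs_expR_half s))//.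
  by rewrite ler_wpM2r ?expR_ge0// (le_trans (cos_max _))// lerDl.
have bsin (x s : R) : `|s * sin (s * x + c) * expR (- s ^+ 2 / 2)| <= 3 * env1 s.
  rewrite !normrM (ger0_norm (expR_ge0 _)) (le_trans _ (abs_expR_half s))//.
  rewrite ler_wpM2r ?expR_ge0//.
  by have := sin_max (s * x + c); have := normr_ge0 s; nra.
have ce : continuous (fun s : R => expR (- s ^+ 2 / 2)).
  move=> s; apply: continuous_comp; last exact: continuous_expR.
  by apply: cvgMl; apply: cvgN; exact: sqr_continuous.
have cl (x : R) : continuous (fun s : R => s * x + c).
  by move=> s; apply: cvgD; [apply: cvgMl; exact: cvg_id|exact: cvg_cst].
have ccos (x : R) : continuous (fun s : R => cos (s * x + c) * expR (- s ^+ 2 / 2)).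
  move=> s; apply: cvgM; last exact: ce.
  by apply: continuous_comp; [exact: cl|exact: continuous_cos].
have csin (x : R) : continuous (fun s : R => s * sin (s * x + c) * expR (- s ^+ 2 / 2)).
  move=> s; apply: cvgM; last exact: ce.
  apply: cvgM; first exact: cvg_id.
  by apply: continuous_comp; [exact: cl|exact: continuous_sin].
have icos x := cont_dom_integrable (ccos x) (bcos x).
have isin x := cont_dom_integrable (csin x) (bsin x).
have dcos (s x : R) : is_derive x (1 : R) (fun x => cos (s * x + c) * expR (- s ^+ 2 / 2))
    (- (s * sin (s * x + c) * expR (- s ^+ 2 / 2))).
  have d1 : is_derive x (1 : R) (fun x : R => s * x + c) s.
    apply: is_derive_eq (is_deriveD (is_deriveZ s (is_derive_id x 1)) (is_derive_cst c x 1)) _.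
    by rewrite /GRing.scale/= mulr1 addr0.
  apply: is_derive_eq (is_deriveM (is_derive1_comp (is_derive_cos _) d1)
    (is_derive_cst (expR (- s ^+ 2 / 2)) x 1)) _.
  by rewrite /GRing.scale/=; ring.
(* An exact derivative in [s]: its integral vanishes, which is the integration by parts needed for
   the equation of [phi]. *)
have dsin (x s : R) : is_derive s (1 : R) (fun s => sin (s * x + c) * expR (- s ^+ 2 / 2))
    (x * (cos (s * x + c) * expR (- s ^+ 2 / 2)) - s * sin (s * x + c) * expR (- s ^+ 2 / 2)).
  have d1 : is_derive s (1 : R) (fun s : R => s * x + c) x.
    apply: is_derive_eq (is_deriveD (is_deriveM (is_derive_id s 1) (is_derive_cst x s 1)) (is_derive_cst c s 1)) _.
    by rewrite /GRing.scale/=; ring.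
  have d2 : is_derive s (1 : R) (fun s : R => - s ^+ 2 / 2) (- s).
    rewrite (_ : (fun s => _) = (fun s : R => (- 2^-1) *: (s ^+ 2 : R^o))); last first.
      by apply/funext => y; rewrite /GRing.scale/=; field.
    apply: is_derive_eq (is_deriveZ (- 2^-1) (is_derive_sqr s)) _.
    by rewrite /GRing.scale/=; field.
  apply: is_derive_eq (is_deriveM (is_derive1_comp (is_derive_sin _) d1)
    (is_derive1_comp (is_derive_expR _) d2)) _.
  by rewrite /GRing.scale/=; ring.
have dphi (x : R) : is_derive x (1 : R) phi (- (x * phi x)).
  have Ix : `]x - 1, x + 1[%classic x by rewrite /= in_itv/=; lra.
  have dE y s : partial1of2 (fun x s => cos (s * x + c) * expR (- s ^+ 2 / 2)) y s =
      - (s * sin (s * y + c) * expR (- s ^+ 2 / 2)).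
    by rewrite partial1of2E; have [_ ->] := dcos s y.
  have i3 := integrableZl measurableT 3 (@env1_integrable R).
  have G0 (s : R) : 0 <= 3 * env1 s by rewrite mulr_ge0 ?expR_ge0.
  have db y s : `]x - 1, x + 1[%classic y -> [set: R] s ->
     `|partial1of2 (fun x s => cos (s * x + c) * expR (- s ^+ 2 / 2)) y s| <= 3 * env1 s.
    by move=> _ _; rewrite dE normrN bsin.
  have der y s : `]x - 1, x + 1[%classic y -> [set: R] s ->
     derivable (fun x => cos (s * x + c) * expR (- s ^+ 2 / 2)) y 1 by [].
  apply: DeriveDef.
    exact: (derivable_under_integral measurableT Ix (fun x _ => icos x) der G0 i3 db).
  rewrite -derive1E
    (differentiation_under_integral measurableT Ix (fun x _ => icos x) der G0 i3 db).
  under eq_Rintegral do rewrite dE.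
  have iN : mu.-integrable [set: R] (EFin \o (fun s => x * (cos (s * x + c) * expR (- s ^+ 2 / 2)))).
    exact: (integrableZl measurableT x (icos x)).
  have := @integral_derivative0 _ _ ((1 + `|x|) * 3) (dsin x).
  rewrite RintegralB//.
  rewrite RintegralZl// -/(phi x) => E.
  under eq_Rintegral do rewrite -mulN1r.
  rewrite RintegralZl//.
  rewrite mulN1r; congr (- _); apply/esym/eqP; rewrite -subr_eq0; apply/eqP; apply: E.
  - by move=> s; apply: cvgB; [apply: cvgMr; exact: ccos|exact: csin].
  - move=> s; rewrite normrM (ger0_norm (expR_ge0 _)) -mulrA mulrDl mul1r.
    rewrite (@le_trans _ _ (3 * env1 s))//; last by rewrite lerDl !mulr_ge0 ?expR_ge0.
    rewrite (le_trans _ (abs_expR_half s))// ler_wpM2r ?expR_ge0//.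
    by rewrite (le_trans (sin_max _))// lerDl.
  - move=> s; rewrite (le_trans (ler_normB _ _))//.
    rewrite (_ : (1 + `|x|) * 3 * env1 s = `|x| * (3 * env1 s) + 3 * env1 s); last by ring.
    by rewrite lerD// normrM ler_wpM2l.
(* The equation is solved by multiplying with the inverse Gaussian; the value at 0 is the Gaussian
   integral. *)
have const : phi xi * expR (xi ^+ 2 / 2) = phi 0 * expR (0 ^+ 2 / 2).
  apply: (@is_derive_0_is_cst _ (fun x => phi x * expR (x ^+ 2 / 2))) => x.
  have d2 : is_derive x (1 : R) (fun s : R => s ^+ 2 / 2) x.
    rewrite (_ : (fun s => _) = (fun s : R => (2^-1) *: (s ^+ 2 : R^o))); last first.
      by apply/funext => y; rewrite /GRing.scale/=; field.
    apply: is_derive_eq (is_deriveZ (2^-1) (is_derive_sqr x)) _.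
    by rewrite /GRing.scale/=; field.
  apply: is_derive_eq (is_deriveM (dphi x) (is_derive1_comp (is_derive_expR _) d2)) _.
  by rewrite /GRing.scale/=; ring.
have p0 : phi 0 = Num.sqrt (2 * pi) * cos c.
  rewrite /phi.
  have [i1 e1] := @integral_gauss1 R 0 1 (oner_neq0 R).
  have E (s : R) : expR (- (s - 0) ^+ 2 / (1 ^+ 2 *+ 2)) = expR (- s ^+ 2 / 2).
    by rewrite subr0 expr1n.
  transitivity (\int[mu]_s (cos c * expR (- (s - 0) ^+ 2 / (1 ^+ 2 *+ 2)))).
    by apply: eq_Rintegral => s _; rewrite E mulr0 add0r.
  by rewrite RintegralZl// e1 mulrC expr1n mul1r mulr_natl.
apply: (mulIf (lt0r_neq0 (expR_gt0 (xi ^+ 2 / 2)))); rewrite -/(phi xi) const p0.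
by rewrite expr0n/= mul0r expR0 mulr1 mulNr expRN mulrAC divfK// gt_eqF// expR_gt0.
Qed.

(** * Squared norms, dot products and Gaussian integrals in several variables *)

Definition sqn n (x : 'rV[R]_n) : R := \sum_(i < n) x 0 i ^+ 2.

Lemma sqn_ge0 n (x : 'rV[R]_n) : 0 <= sqn x.
Proof. by apply: sumr_ge0 => i _; exact: sqr_ge0. Qed.

Lemma sqn_le n (x l : 'rV[R]_n) : sqn x <= 2 * (sqn (x - l) + sqn l).
Proof.
rewrite /sqn -big_split/= mulr_sumr ler_sum// => i _.
by rewrite !mxE; have := sqr_ge0 (x 0 i - 2 * l 0 i); nra.
Qed.

Lemma vnorm_sqr n (x : 'rV[R]_n) : vnorm x ^+ 2 = sqn x.
Proof. by rewrite sqr_sqrtr// sqn_ge0. Qed.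

Definition tailv n (x : 'rV[R]_n.+1) : 'rV[R]_n := \row_i x 0 (lift ord0 i).

Lemma vdot_consv n s (y : 'rV[R]_n) xi :
  vdot (consv s y) xi = s * xi 0 ord0 + vdot y (tailv xi).
Proof.
rewrite /vdot big_ord_recl consv0; congr (_ + _).
by apply: eq_bigr => i _; rewrite consvS mxE.
Qed.

Lemma sqn_consv n s (y : 'rV[R]_n) : sqn (consv s y) = s ^+ 2 + sqn y.
Proof.
rewrite /sqn big_ord_recl consv0; congr (_ + _).
by apply: eq_bigr => i _; rewrite consvS.
Qed.

Lemma sqn_tailv n (x : 'rV[R]_n.+1) : sqn x = x 0 ord0 ^+ 2 + sqn (tailv x).
Proof.
by rewrite /sqn big_ord_recl; congr (_ + _); apply: eq_bigr => i _; rewrite mxE.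
Qed.

Lemma consvB n s (y : 'rV[R]_n) (l : 'rV[R]_n.+1) :
  consv s y - l = consv (s - l 0 ord0) (y - tailv l).
Proof.
apply/rowP => i; rewrite [LHS]mxE [X in _ + X]mxE.
by case: (unliftP ord0 i) => [j ->|->]; rewrite ?consvS ?consv0// !mxE.
Qed.

Lemma seqcont_subr n (l : 'rV[R]_n) (F : 'rV[R]_n -> R) :
  seqcont F -> seqcont (fun x => F (x - l)).
Proof.
move=> sF xs x h; apply: sF => i; rewrite !mxE.
by under eq_fun do rewrite !mxE; apply: cvgD; [exact: h|exact: cvg_cst].
Qed.

Lemma seqcont_sqn n : seqcont (@sqn n).
Proof.
apply: seqcont_sum => i.
by apply: (@seqcont_comp _ _ (fun s => s ^+ 2) (fun x => x 0 i)); [exact: sqr_continuous|exact: seqcont_coord].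
Qed.

Lemma seqcont_vdot n (l : 'rV[R]_n) : seqcont (fun x => vdot x l).
Proof.
by apply: seqcont_sum => i; apply: seqcontM; [exact: seqcont_coord|exact: seqcont_cst].
Qed.

Lemma seqcont_gauss n (b : R) : seqcont (fun x : 'rV[R]_n => expR (- sqn x / b)).
Proof.
apply: (seqcont_comp (g := expR)); first exact: continuous_expR.
apply: seqcontM; last exact: seqcont_cst.
apply: (seqcont_comp (g := -%R)); last exact: seqcont_sqn.
by move=> x; apply: cvgN; exact: cvg_id.
Qed.

(** By [sqn_le], [sqn (x - l) / 4 >= sqn x / 8 - sqn l / 4], so for [b <= 4] the envelope dominates
    up to the factor [expR (sqn l / 4)]. *)
Lemma nice_gauss n (l : 'rV[R]_n) (b : R) : 0 < b -> b <= 4 ->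
  nice (fun x => expR (- sqn (x - l) / b)).
Proof.
move=> b0 b4; split; first exact: (@seqcont_subr _ l _ (@seqcont_gauss n b)).
exists (expR (sqn l / 4)) => x; rewrite ger0_norm ?expR_ge0// /env -expRD ler_expR.
rewrite -/(sqn x); have := sqn_le x l.
have : sqn (x - l) / 4 <= sqn (x - l) / b.
  by rewrite ler_wpM2l ?sqn_ge0// lef_pV2 ?posrE.
by have := sqn_ge0 l; lra.
Qed.

Lemma nice_osc n (l : 'rV[R]_n) (ph : 'rV[R]_n -> R) : seqcont ph ->
  nice (fun x => cos (ph x) * expR (- sqn (x - l) / 2)).
Proof.
move=> sp; apply: (nice_le _ (@nice_gauss _ l 2 ltac:(lra) ltac:(lra))).
  apply: seqcontM; last exact: (@seqcont_subr _ l _ (@seqcont_gauss n 2)).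
  by apply: seqcont_comp sp; exact: continuous_cos.
by move=> x; rewrite normrM ler_piMl// cos_max.
Qed.

Lemma nice_osc0 n (ph : 'rV[R]_n -> R) : seqcont ph ->
  nice (fun x => cos (ph x) * expR (- sqn x / 2)).
Proof. by move=> /(nice_osc 0); under eq_fun do rewrite subr0. Qed.

(** The integral splits coordinate by coordinate; in the induction the free phase [c] absorbs the
    term [s * xi 0 ord0] of the first coordinate. *)
Lemma Rint_gauss_cos n (xi : 'rV[R]_n) c :
  Rint (fun x => cos (vdot x xi + c) * expR (- sqn x / 2)) =
  Num.sqrt (2 * pi) ^+ n * expR (- sqn xi / 2) * cos c.
Proof.
elim: n xi c => [xi c|n IH xi c].
  by rewrite /= /vdot /sqn !big_ord0 add0r oppr0 mul0r expR0 expr0 !mul1r mulr1.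
rewrite RintS.
transitivity (\int[mu]_s (Num.sqrt (2 * pi) ^+ n * expR (- sqn (tailv xi) / 2) *
   (cos (s * xi 0 ord0 + c) * expR (- s ^+ 2 / 2)))).
  apply: eq_Rintegral => s _.
  transitivity (expR (- s ^+ 2 / 2) * Rint (fun y =>
      cos (vdot y (tailv xi) + (s * xi 0 ord0 + c)) * expR (- sqn y / 2))).
    rewrite -RintZ; last first.
      by apply: nice_osc0; apply: seqcontD; [exact: seqcont_vdot|exact: seqcont_cst].
    apply: eq_Rint => y; rewrite vdot_consv sqn_consv.
    rewrite (_ : - (s ^+ 2 + sqn y) / 2 = - s ^+ 2 / 2 + - sqn y / 2); last by field.
    by rewrite expRD addrA (addrC (vdot _ _)); ring.
  by rewrite IH; ring.
rewrite RintegralZl//; last first.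
  apply: (@cont_dom_integrable _ _ 3) => s.
    apply: cvgM; apply: continuous_comp.
    - by apply: cvgD; [apply: cvgMl; exact: cvg_id|exact: cvg_cst].
    - exact: continuous_cos.
    - by apply: cvgMl; apply: cvgN; exact: sqr_continuous.
    - exact: continuous_expR.
  rewrite normrM (ger0_norm (expR_ge0 _)) (le_trans _ (abs_expR_half s))//.
  by rewrite ler_wpM2r ?expR_ge0// (le_trans (cos_max _))// lerDl.
rewrite gauss_cos1 (_ : - sqn xi / 2 = - xi 0 ord0 ^+ 2 / 2 + - sqn (tailv xi) / 2); last first.
  by rewrite sqn_tailv; field.
by rewrite expRD [_ ^+ n.+1]exprS; ring.
Qed.

Lemma Rint_gauss n (l : 'rV[R]_n) (b : R) : 0 < b -> b <= 4 ->
  Rint (fun x => expR (- sqn (x - l) / b)) = Num.sqrt (b * pi) ^+ n.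
Proof.
move=> b0 b4; elim: n l => [l|n IH l].
  by rewrite /= /sqn big_ord0 oppr0 mul0r expR0 expr0.
have s2 : Num.sqrt (b / 2) != 0 :> R by rewrite gt_eqF// sqrtr_gt0; lra.
have s2' : Num.sqrt (b / 2) ^+ 2 *+ 2 = b :> R.
  rewrite sqr_sqrtr; last lra.
  by rewrite -[_ *+ _]mulr_natr divfK ?pnatr_eq0.
have [i1 e1] := integral_gauss1 (l 0 ord0) s2.
rewrite RintS.
transitivity (\int[mu]_s (Num.sqrt (b * pi) ^+ n *
   expR (- (s - l 0 ord0) ^+ 2 / (Num.sqrt (b / 2) ^+ 2 *+ 2)))).
  apply: eq_Rintegral => s _.
  transitivity (expR (- (s - l 0 ord0) ^+ 2 / b) *
      Rint (fun y => expR (- sqn (y - tailv l) / b))).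
    rewrite -RintZ; last exact: nice_gauss.
    apply: eq_Rint => y; rewrite consvB sqn_consv -expRD; congr expR.
    by field; rewrite gt_eqF.
  by rewrite IH s2' mulrC.
by rewrite RintegralZl// e1 [_ ^+ n.+1]exprSr -mulrnAl s2'.
Qed.

End GaussianFourier.

(** * Gaussian wave packets *)

Section WavePackets.
Local Open Scope classical_set_scope.
Context {R : realType}.
Local Notation mu := (@lebesgue_measure R).
Local Notation Rint := Defs.Rint.

Lemma is_derive_dir n (g : 'rV[R]_n -> R) (x v : 'rV[R]_n) (d : R) :
  is_derive (0 : R) (1 : R) (fun h : R => g (h *: v + x)) d -> is_derive x v g d.
Proof.
move=> [h1 h2]; apply: DeriveDef; first by apply/derivable1P.
rewrite -h2 /derive; set g1 := fun h => h^-1 *: _; set g2 := fun h => h^-1 *: _.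
suff -> : g1 = g2 by [].
by apply/funext => h; rewrite /g1 /g2/= addr0 scale0r add0r [_%:A]mulr1.
Qed.

(** A class closed under partial derivatives, on which the Schwartz bounds follow by induction. The
    free phase [c] provides the sines that differentiation produces. *)
Inductive trig_gauss n : ('rV[R]_n -> R) -> Prop :=
| tg_base l c : trig_gauss (fun x => cos (vdot x l + c) * expR (- sqn x / 2))
| tg_coord i g : trig_gauss g -> trig_gauss (fun x => x 0 i * g x)
| tg_add g h : trig_gauss g -> trig_gauss h -> trig_gauss (fun x => g x + h x)
| tg_scale a g : trig_gauss g -> trig_gauss (fun x => a * g x).

Lemma trig_gauss_sum n (I : Type) (s : seq I) (g : I -> 'rV[R]_n -> R) :
  (forall i, trig_gauss (g i)) -> trig_gauss (fun x => \sum_(i <- s) g i x).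
Proof.
move=> h; elim: s => [|i s IH].
  rewrite (_ : (fun x => _) = (fun x => 0 * (cos (vdot x 0 + 0) * expR (- sqn x / 2)))).
    by apply: tg_scale; exact: tg_base.
  by apply/funext => x; rewrite big_nil mul0r.
rewrite (_ : (fun x => _) = (fun x => g i x + \sum_(j <- s) g j x)).
  exact: tg_add.
by apply/funext => x; rewrite big_cons.
Qed.

Lemma is_derive_affine (a b x : R) : is_derive x (1 : R) (fun h => h * a + b) a.
Proof.
apply: is_derive_eq (is_deriveD (is_deriveM (is_derive_id x 1) (is_derive_cst a x 1)) (is_derive_cst b x 1)) _.
by rewrite /GRing.scale/=; ring.
Qed.

Lemma vdot_line n (h : R) (v x l : 'rV[R]_n) :
  vdot (h *: v + x) l = h * vdot v l + vdot x l.
Proof.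
rewrite /vdot mulr_sumr -big_split; apply: eq_bigr => i _ /=.
by rewrite !mxE; ring.
Qed.

Lemma vdot_delta n i (l : 'rV[R]_n) : vdot (delta_mx 0 i) l = l 0 i.
Proof.
rewrite /vdot (bigD1 i)//= mxE !eqxx mul1r big1 ?addr0// => j ji.
by rewrite mxE (negbTE ji) mul0r.
Qed.

Lemma sqn_vdot n (x : 'rV[R]_n) : sqn x = vdot x x.
Proof. by apply: eq_bigr => i _; rewrite expr2. Qed.

Lemma vdotC n (x y : 'rV[R]_n) : vdot x y = vdot y x.
Proof. by apply: eq_bigr => i _; rewrite mulrC. Qed.

Lemma trig_gauss_derive n (g : 'rV[R]_n -> R) (i : 'I_n) : trig_gauss g ->
  exists2 g', trig_gauss g' & forall x, is_derive x (delta_mx 0 i) g (g' x).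
Proof.
elim=> {g} [l c|j g tg [g' tg' dg]|g h tg [g' tg' dg] th [h' th' dh]|a g tg [g' tg' dg]].
- exists (fun x => - l 0 i * (cos (vdot x l + (c - pi / 2)) * expR (- sqn x / 2)) +
             -1 * (x 0 i * (cos (vdot x l + c) * expR (- sqn x / 2)))).
    apply: tg_add; apply: tg_scale; first exact: tg_base.
    by apply: tg_coord; exact: tg_base.
  move=> x; apply: is_derive_dir.
  rewrite (_ : (fun h => _) = (fun h => cos (h * l 0 i + (vdot x l + c)) *
     expR (h * (- x 0 i + - (h / 2)) + (- sqn x / 2)))); last first.
    apply/funext => h; rewrite vdot_line vdot_delta addrA; congr (_ * expR _).
    rewrite !sqn_vdot vdot_line !(vdotC _ (_ + _)) !vdot_line (vdotC x) !vdot_delta.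
    by rewrite !mxE !eqxx /=; field.
  have d2 : is_derive (0 : R) (1 : R) (fun h => h * (- x 0 i + - (h / 2)) + (- sqn x / 2)) (- x 0 i).
    have d3 : is_derive (0 : R) (1 : R) (fun h => - x 0 i + - (h / 2)) (- 2^-1).
      rewrite (_ : (fun h => _) = (fun h => h * (- 2^-1) + - x 0 i)).
        exact: is_derive_affine.
      by apply/funext => h; ring.
    apply: is_derive_eq (is_deriveD (is_deriveM (is_derive_id (0 : R) (1 : R)) d3) (is_derive_cst (- sqn x / 2) (0 : R) (1 : R))) _.
    by rewrite /GRing.scale/=; ring.
  apply: is_derive_eq (is_deriveM (is_derive1_comp (is_derive_cos _) (is_derive_affine _ _ _))
    (is_derive1_comp (is_derive_expR _) d2)) _.
  rewrite /GRing.scale/= !mul0r !add0r addrA cosBpihalf; ring.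
- exists (fun x : 'rV[R]_n => x 0 j * g' x + (i == j)%:R * g x).
    by apply: tg_add; [exact: tg_coord|exact: tg_scale].
  move=> x.
  have dj : is_derive x (delta_mx 0 i) (fun x : 'rV[R]_n => x 0 j) (i == j)%:R.
    apply: is_derive_dir.
    rewrite (_ : (fun h => _) = (fun h => h * (i == j)%:R + x 0 j)).
      exact: is_derive_affine.
    by apply/funext => h; rewrite !mxE eqxx eq_sym.
  apply: is_derive_eq (is_deriveM dj (dg x)) _.
  by rewrite /GRing.scale/=; ring.
- exists (fun x => g' x + h' x); first exact: tg_add.
  by move=> x; exact: is_deriveD.
- exists (fun x => a * g' x); first exact: tg_scale.
  move=> x; apply: is_derive_eq (is_deriveM (is_derive_cst a x (delta_mx 0 i)) (dg x)) _.
  by rewrite /GRing.scale/=; ring.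
Qed.

Lemma trig_gauss_iterD n (g : 'rV[R]_n -> R) bs : trig_gauss g -> trig_gauss (Defs.iterD bs g).
Proof.
move=> tg; elim: bs => //= i bs IH.
have [g' tg' d] := trig_gauss_derive i IH.
rewrite (_ : (fun x => _) = g')//; apply/funext => x.
by have [_ ->] := d x.
Qed.

Lemma pow_exp_bound k : exists M : R, forall y, 0 <= y -> (1 + y) ^+ k * expR (- y / 2) <= M.
Proof.
(* Raise [1 + y <= 2 (k + 1) exp (y / (2 (k + 1)))] to the power [k]; taking [k.+1] avoids a
   division by zero. *)
exists ((2 * k.+1%:R) ^+ k) => y y0.
have k0 : (0 : R) < 2 * k.+1%:R by rewrite mulr_gt0.
rewrite mulNr expRN ler_pdivrMr ?expR_gt0//.
apply: (@le_trans _ _ ((2 * k.+1%:R) ^+ k * expR (y / (2 * k.+1%:R)) ^+ k)).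
  rewrite -exprMn lerXn2r ?nnegrE ?mulr_ge0 ?expR_ge0 ?addr_ge0//.
  apply: (@le_trans _ _ (2 * k.+1%:R * (1 + y / (2 * k.+1%:R)))).
    rewrite mulrDr mulr1 mulrCA divff ?gt_eqF// mulr1 lerD2r.
    by rewrite -natrM ler1n.
  by rewrite ler_pM2l// expR_ge1Dx.
rewrite ler_pM2l ?exprn_gt0// -expRM_natl ler_expR.
have -> : y / 2 = k.+1%:R * (y / (2 * k.+1%:R)) by field; rewrite ?pnatr_eq0.
by rewrite ler_wpM2r ?divr_ge0 ?(ltW k0)// ler_nat.
Qed.

Lemma trig_gauss_bound n (g : 'rV[R]_n -> R) k : trig_gauss g ->
  exists M, forall x, (1 + sqn x) ^+ k * `|g x| <= M.
Proof.
move=> tg; elim: tg k => {g} [l c k|j g _ IH k|g h _ IHg _ IHh k|a g _ IH k].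
- have [M hM] := pow_exp_bound k; exists M => x.
  apply: le_trans (hM _ (sqn_ge0 x)).
  rewrite ler_wpM2l ?exprn_ge0 ?addr_ge0 ?sqn_ge0// normrM (ger0_norm (expR_ge0 _)).
  by rewrite ler_piMl ?expR_ge0// cos_max.
(* A coordinate factor costs one more power of the weight, since its absolute value is at most
   [1 + sqn x]. *)
- have [M hM] := IH k.+1; exists M => x; apply: le_trans (hM x).
  rewrite normrM mulrA exprSr ler_wpM2r// ler_wpM2l ?exprn_ge0 ?addr_ge0 ?sqn_ge0//.
  have : x 0 j ^+ 2 <= sqn x.
    by rewrite /sqn (bigD1 j)//= lerDl sumr_ge0// => i _; rewrite sqr_ge0.
  rewrite -(real_normK (num_real (x 0 j))); have := normr_ge0 (x 0 j); nra.
- have [M hM] := IHg k; have [N hN] := IHh k; exists (M + N) => x.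
  apply: le_trans (lerD (hM x) (hN x)).
  by rewrite -mulrDr ler_wpM2l ?exprn_ge0 ?addr_ge0 ?sqn_ge0// ler_normD.
- have [M hM] := IH k; exists (`|a| * M) => x.
  by rewrite normrM mulrCA ler_wpM2l.
Qed.

Lemma trig_gauss_schwartz n (g : 'rV[R]_n -> R) : trig_gauss g -> schwartzR g.
Proof.
move=> tg; split=> [bs i x|k bs].
  by have [g' _ d] := trig_gauss_derive i (trig_gauss_iterD bs tg); have [] := d x.
have [M hM] := trig_gauss_bound k (trig_gauss_iterD bs tg).
by exists M => x; rewrite vnorm_sqr.
Qed.

(** Modulated Gaussians with complex amplitudes [r i * expi (c i)]; the real and imaginary parts are
    written out because each has to be a [trig_gauss] function. *)
Definition packet n (I : Type) (s : seq I) (r c : I -> R) (l : I -> 'rV[R]_n)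
    (x : 'rV[R]_n) : R[i] :=
  Complex (\sum_(i <- s) r i * (cos (vdot x (l i) + c i) * expR (- sqn x / 2)))
          (\sum_(i <- s) r i * (sin (vdot x (l i) + c i) * expR (- sqn x / 2))).

Lemma packet_schwartz n (I : Type) (s : seq I) r c (l : I -> 'rV[R]_n) :
  schwartz (packet s r c l).
Proof.
split; apply: trig_gauss_schwartz; apply: trig_gauss_sum => i; apply: tg_scale.
  exact: tg_base.
have := tg_base (l i) (c i - pi / 2).
by under eq_fun do rewrite addrA cosBpihalf.
Qed.

Lemma fourier_packet n (I : Type) (s : seq I) r c (l : I -> 'rV[R]_n) xi :
  fourier (packet s r c l) xi =
  Complex (\sum_(i <- s) r i * (Num.sqrt (2 * pi) ^+ n * expR (- sqn (xi - l i) / 2) * cos (c i)))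
          (\sum_(i <- s) r i * (Num.sqrt (2 * pi) ^+ n * expR (- sqn (xi - l i) / 2) * sin (c i))).
Proof.
have niceL i th : nice (fun x => cos (vdot x (l i - xi) + th) * expR (- sqn x / 2)).
  by apply: nice_osc0; apply: seqcontD; [exact: seqcont_vdot|exact: seqcont_cst].
have vdB x i : vdot x (l i - xi) = - vdot x xi + vdot x (l i).
  rewrite /vdot -sumrN -big_split; apply: eq_bigr => j _ /=.
  by rewrite !mxE; ring.
have sq i : sqn (xi - l i) = sqn (l i - xi).
  by apply: eq_bigr => j _; rewrite !mxE; ring.
(* One formula for both parts: [th = 0] gives the real part of the transform and [th = - pi / 2] the
   imaginary part. *)
have E th : Rint (fun x => \sum_(i <- s) r i * (cos (vdot x (l i - xi) + (c i + th)) * expR (- sqn x / 2))) =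
   \sum_(i <- s) r i * (Num.sqrt (2 * pi) ^+ n * expR (- sqn (xi - l i) / 2) * cos (c i + th)).
  rewrite Rint_sum => [|i]; last exact: niceZ.
  by apply: eq_bigr => i _; rewrite RintZ// Rint_gauss_cos sq.
rewrite /fourier /Cint; congr Complex.
- transitivity (Rint (fun x => \sum_(i <- s) r i * (cos (vdot x (l i - xi) + (c i + 0)) * expR (- sqn x / 2)))).
    apply: eq_Rint => x /=; rewrite !mulr_sumr -sumrB; apply: eq_bigr => i _.
    by rewrite vdB addr0 -addrA [in RHS]cosD; ring.
  by rewrite E; apply: eq_bigr => i _; rewrite addr0.
- transitivity (Rint (fun x => \sum_(i <- s) r i * (cos (vdot x (l i - xi) + (c i + - (pi / 2))) * expR (- sqn x / 2)))).
    apply: eq_Rint => x /=; rewrite !mulr_sumr -big_split; apply: eq_bigr => i _ /=.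
    by rewrite addrA cosBpihalf vdB -addrA [in RHS]sinD; ring.
  by rewrite E; apply: eq_bigr => i _; rewrite cosBpihalf.
Qed.

End WavePackets.

(** * The propagator on wave packets *)

Section Estimates.
Local Open Scope classical_set_scope.
Context {R : realType}.
Local Notation mu := (@lebesgue_measure R).
Local Notation Rint := Defs.Rint.

(** * Elementary inequalities for sine, cosine and real powers *)

Lemma lipschitz1 (f df : R -> R) (x y : R) :
  (forall x : R, is_derive x (1 : R) f (df x)) -> (forall x, `|df x| <= 1) ->
  `|f x - f y| <= `|x - y|.
Proof.
move=> d b; wlog xy : x y / y <= x.
  by move=> h; have [/h//|/ltW/h] := leP y x; rewrite distrC (distrC x).
have [|c _ ->] := MVT_segment xy (fun z _ => d z).
  by apply: continuous_subspaceT => z; apply/differentiable_continuous/derivable1_diffP.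
by rewrite normrM ler_piMl.
Qed.

Lemma cos_lipschitz (x y : R) : `|cos x - cos y| <= `|x - y|.
Proof.
by apply: (lipschitz1 _ _ (df := fun x => - sin x)) => z; rewrite normrN sin_max.
Qed.

Lemma sin_lipschitz (x y : R) : `|sin x - sin y| <= `|x - y|.
Proof. by apply: (lipschitz1 _ _ (df := cos)) => z; rewrite cos_max. Qed.

(** Half-angle formula, with [sin (x / 2)] at most 1/2 in absolute value by the Lipschitz bound. *)
Lemma cos_ge_half (x : R) : `|x| <= 1 -> 2^-1 <= cos x.
Proof.
move=> x1.
have -> : cos x = 1 - sin (x / 2) ^+ 2 *+ 2.
  by rewrite -[in LHS](@divfK _ 2 _ x)// mulr_natr cos_mulr2n cos2sin2 mulrnBl addrAC -addrA; ring.
have := sin_lipschitz (x / 2) 0; rewrite sin0 !subr0 normrM (ger0_norm (_ : 0 <= 2^-1))//.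
rewrite -(real_normK (num_real (sin _))) => h.
have := normr_ge0 (sin (x / 2)); rewrite [`|_| ^+ 2 *+ 2]mulr2n; nra.
Qed.

(** Mean value theorem from 0: [sin x = x * cos c] with both factors at least 1/2. *)
Lemma sin_ge_quarter (x : R) : 2^-1 <= x <= 1 -> 4^-1 <= sin x.
Proof.
move=> /andP[x0 x1].
have xx : 0 <= x by lra.
have [|c c01 e] := MVT_segment xx (fun z _ => is_derive_sin z).
  by apply: continuous_subspaceT; exact: continuous_sin.
move: e; rewrite sin0 !subr0 => ->.
have : 2^-1 <= cos c by apply: cos_ge_half; move: c01; rewrite in_itv/= ler_norml; lra.
nra.
Qed.

(** The shares [p / (p + q)] and [q / (p + q)] add up to 1, and a number of [[0, 1]] is at most its
    power of exponent [b <= 1]. *)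
Lemma powR_subadd (b p q : R) : 0 < b -> b <= 1 -> 0 <= p -> 0 <= q ->
  (p + q) `^ b <= p `^ b + q `^ b.
Proof.
move=> b0 b1 p0 q0; have [s0|s0] := leP (p + q) 0.
  have -> : p + q = 0 by apply/eqP; rewrite eq_le s0 addr_ge0.
  by rewrite powR0 ?gt_eqF// addr_ge0 ?powR_ge0.
have aux r : 0 <= r -> r <= p + q -> r / (p + q) * (p + q) `^ b <= r `^ b.
  move=> r0 rs; have [->|rn0] := eqVneq r 0; first by rewrite !mul0r powR_ge0.
  have rp : 0 < r by rewrite lt_neqAle eq_sym rn0.
  have e : r = (r / (p + q)) * (p + q) by rewrite divfK// gt_eqF.
  rewrite [in leRHS]e powRM ?divr_ge0 ?(ltW s0)// ler_wpM2r ?powR_ge0//.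
  by apply: ger1_powR => //; rewrite divr_gt0//= ler_pdivrMr// mul1r.
have := aux p p0; have := aux q q0; rewrite lerDl lerDr => /(_ p0) h1 /(_ q0) h2.
apply: le_trans (lerD h2 h1); rewrite -mulrDl -mulrDl divff ?gt_eqF// mul1r.
exact: lexx.
Qed.

(** Applied with [b = a / 2] to squared norms of frequencies, where [b <= 1] is the assumption
    [a <= 2]. *)
Lemma powR_holder (b p q : R) : 0 < b -> b <= 1 -> 0 <= p -> 0 <= q ->
  `|p `^ b - q `^ b| <= `|p - q| `^ b.
Proof.
move=> b0 b1; wlog pq : p q / q <= p.
  by move=> h p0 q0; have [/h->//|/ltW/h] := leP q p; rewrite distrC (distrC p) => ->.
move=> p0 q0; rewrite !ger0_norm ?subr_ge0//; last first.
  by apply: ge0_ler_powR => //; exact: ltW.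
rewrite lerBlDr; have := @powR_subadd b (p - q) q b0 b1.
by rewrite subrK subr_ge0 => /(_ pq q0).
Qed.

Lemma seqcont_powR n (b : R) (F : 'rV[R]_n -> R) : 0 < b -> b <= 1 ->
  (forall x, 0 <= F x) -> seqcont F -> seqcont (fun x => F x `^ b).
Proof.
move=> b0 b1 F0 sF xs x h; apply/cvgrPdist_lt => e e0.
have e' : 0 < e `^ b^-1 by rewrite powR_gt0.
have /cvgrPdist_lt/(_ _ e') := sF _ _ h; apply: filterS => m hm.
apply: (le_lt_trans (powR_holder b0 b1 (F0 _) (F0 _))).
have -> : e = (e `^ b^-1) `^ b by rewrite -powRrM mulVf ?gt_eqF// powRr1 ?ltW.
by apply: gt0_ltr_powR => //; rewrite nnegrE ?powR_ge0.
Qed.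

Lemma vnorm_powR n (x : 'rV[R]_n) a : vnorm x `^ a = sqn x `^ (a / 2).
Proof. by rewrite /vnorm -powR12_sqrt ?sqn_ge0// -powRrM mulrC. Qed.

Section Propagator.
Variables (a : R) (n : nat).
Hypotheses (a0 : 0 < a) (a2 : a <= 2).

(** Real part of the evolution of one packet. The factor combines [(2 pi)^(-n)] from Fourier
    inversion with [sqrt (2 pi)^n] from the transform of the Gaussian. *)
Definition wave (t : R) (x l : 'rV[R]_n) (c : R) : R :=
  (Num.sqrt (2 * pi) ^+ n)^-1 *
  Rint (fun xi => cos (vdot x xi + t * vnorm xi `^ a + c) * expR (- sqn (xi - l) / 2)).

Lemma seqcont_phase t x c : seqcont (fun xi : 'rV[R]_n => vdot x xi + t * vnorm xi `^ a + c).
Proof.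
apply: seqcontD; last exact: seqcont_cst.
apply: seqcontD.
  by rewrite (_ : vdot x = (fun xi => vdot xi x)); [exact: seqcont_vdot|apply/funext => xi; rewrite vdotC].
apply: seqcontM; first exact: seqcont_cst.
under eq_fun do rewrite vnorm_powR.
have h1 : 0 < a / 2 by rewrite divr_gt0.
have h2 : a / 2 <= 1 by rewrite ler_pdivrMr// mul1r.
exact: (@seqcont_powR _ _ (@sqn R n) h1 h2 (@sqn_ge0 _ _) (@seqcont_sqn _ _)).
Qed.

Lemma nice_wave t (x l : 'rV[R]_n) c :
  nice (fun xi => cos (vdot x xi + t * vnorm xi `^ a + c) * expR (- sqn (xi - l) / 2)).
Proof. by apply: nice_osc; exact: seqcont_phase. Qed.

Lemma Re_prop_op_packet (I : Type) (s : seq I) r c (l : I -> 'rV[R]_n) t x :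
  complex.Re (prop_op a t (packet s r c l) x) = \sum_(i <- s) r i * wave t x (l i) (c i).
Proof.
have p0 : 0 < Num.sqrt (2 * pi) :> R by rewrite sqrtr_gt0 mulr_gt0 ?pi_gt0.
have -> : complex.Re (prop_op a t (packet s r c l) x) = ((2 * pi) ^+ n)^-1 *
   Rint (fun xi => \sum_(i <- s) r i * (Num.sqrt (2 * pi) ^+ n *
     (cos (vdot x xi + t * vnorm xi `^ a + c i) * expR (- sqn (xi - l i) / 2)))).
  rewrite /prop_op (funext (fourier_packet s r c l)) /Cint /= mul0r subr0.
  congr (_ * _); apply: eq_Rint => xi; rewrite /= !mulr_sumr -sumrB; apply: eq_bigr => i _.
  by rewrite [in RHS]cosD; ring.
rewrite Rint_sum; last by move=> i; do 2 apply: niceZ; exact: nice_wave.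
rewrite mulr_sumr; apply: eq_bigr => i _.
rewrite RintZ; last by apply: niceZ; exact: nice_wave.
rewrite RintZ; last exact: nice_wave.
have e : (2 * pi) ^+ n = Num.sqrt (2 * pi) ^+ n * Num.sqrt (2 * pi) ^+ n :> R.
  by rewrite -exprMn -expr2 sqr_sqrtr// mulr_ge0 ?pi_ge0.
rewrite e /wave; have : Num.sqrt (2 * pi) ^+ n != 0 :> R by rewrite gt_eqF ?exprn_gt0.
by move=> q0; field.
Qed.

(** Dominated convergence in frequency; continuity in time later yields the measurability of the
    lower bounds. *)
Lemma continuous_wave x l c : continuous (fun t => wave t x l c).
Proof.
move=> t; apply: cvgMr; apply/(@cvg_nbhsP _ R^o) => u ut.
have [M hM] := (@nice_gauss _ n l 2 ltac:(lra) ltac:(lra)).2.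
apply: ((Rint_bound_cvg n).2 (fun m xi => cos (vdot x xi + u m * vnorm xi `^ a + c) * expR (- sqn (xi - l) / 2)) _ M).
- by move=> m; exact: (nice_wave _ _ _ _).1.
- exact: (nice_wave _ _ _ _).1.
- move=> m xi; apply: le_trans (hM xi).
  by rewrite normrM ler_piMl// cos_max.
- move=> xi; apply: cvgMl; apply: continuous_cvg; first exact: continuous_cos.
  by apply: cvgD; [apply: cvgD; [exact: cvg_cst|exact: cvgMl]|exact: cvg_cst].
Qed.

Lemma gauss_moment_le (y : R) : 0 <= y -> (1 + y) * expR (- y / 2) <= 4 * expR (- y / 4).
Proof.
move=> y0; have -> : - y / 2 = - (y / 4) + - y / 4 by field.
rewrite expRD mulrA ler_wpM2r ?expR_ge0// expRN ler_pdivrMr ?expR_gt0//.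
by have := expR_ge1Dx (y / 4); lra.
Qed.

(** Both terms are averages over a Gaussian centred at [l], so the Lipschitz bound for the cosine
    reduces the claim to the phase difference. The factor [1 + sqn eta] is absorbed by widening the
    Gaussian ([gauss_moment_le]), which multiplies its mass by [sqrt 2 ^ n]. *)
Lemma wave_approx t x l c kappa : 0 <= kappa ->
  (forall eta, `|vdot x eta + t * (vnorm (l + eta) `^ a - vnorm l `^ a)| <= kappa * (1 + sqn eta)) ->
  `|wave t x l c - cos (vdot x l + t * vnorm l `^ a + c)| <= kappa * (4 * Num.sqrt 2 ^+ n).
Proof.
move=> k0 h; set th := vdot x l + _ + c.
have p0 : 0 < Num.sqrt (2 * pi) :> R by rewrite sqrtr_gt0 mulr_gt0 ?pi_gt0.
have q0 : 0 < Num.sqrt (2 * pi) ^+ n :> R by rewrite exprn_gt0.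
have ng : nice (fun xi => expR (- sqn (xi - l) / 2)) by apply: nice_gauss; lra.
have ng4 : nice (fun xi => expR (- sqn (xi - l) / 4)) by apply: nice_gauss; lra.
have -> : wave t x l c - cos th = (Num.sqrt (2 * pi) ^+ n)^-1 *
   Rint (fun xi => cos (vdot x xi + t * vnorm xi `^ a + c) * expR (- sqn (xi - l) / 2) +
      (- cos th) * expR (- sqn (xi - l) / 2)).
  rewrite RintD; [|exact: nice_wave|exact: niceZ].
  rewrite RintZ// Rint_gauss; [|lra|lra].
  by rewrite /wave; field; rewrite gt_eqF.
rewrite normrM (ger0_norm (_ : 0 <= _^-1)) ?invr_ge0 ?(ltW q0)// mulrC ler_pdivrMr//.
have -> : kappa * (4 * Num.sqrt 2 ^+ n) * Num.sqrt (2 * pi) ^+ n =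
    Rint (fun xi => kappa * 4 * expR (- sqn (xi - l) / 4)).
  rewrite RintZ// Rint_gauss; [|lra|lra].
  rewrite -!mulrA -exprMn -sqrtrM//; congr (_ * (_ * (Num.sqrt _ ^+ _))); ring.
apply: Rint_abs_le; [|exact: niceZ|].
  by apply: niceD; [exact: nice_wave|exact: niceZ].
move=> xi; rewrite -mulrDl normrM (ger0_norm (expR_ge0 _)).
rewrite -mulrA; apply: le_trans (ler_wpM2l k0 (gauss_moment_le (sqn_ge0 (xi - l)))).
rewrite mulrA ler_wpM2r ?expR_ge0//; apply: le_trans (h (xi - l)).
apply: le_trans (cos_lipschitz _ _) _.
have -> : l + (xi - l) = xi by rewrite addrC subrK.
have -> : vdot x (xi - l) = vdot x xi - vdot x l.
  by rewrite /vdot -sumrB; apply: eq_bigr => i _; rewrite !mxE; ring.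
by rewrite le_eqVlt; apply/orP; left; apply/eqP; congr `|_|; rewrite /th; ring.
Qed.

End Propagator.
End Estimates.

(** * Sobolev norms of sums of packets *)

Section SobolevNorm.
Local Open Scope classical_set_scope.
Context {R : realType}.
Local Notation mu := (@lebesgue_measure R).
Local Notation Rint := Defs.Rint.

(** Weighted Cauchy-Schwarz: sum [(A p - tau)^2 >= 0] with weights [g p] and take [tau = S1 / G]. *)
Lemma sqr_sum_le (P : Type) (ps : seq P) (A g : P -> R) (G : R) : 0 < G ->
  (forall p, 0 <= g p) -> \sum_(p <- ps) g p <= G ->
  (\sum_(p <- ps) A p * g p) ^+ 2 <= G * \sum_(p <- ps) A p ^+ 2 * g p.
Proof.
move=> G0 g0 hG; set S1 := \sum_(p <- ps) A p * g p; set S2 := \sum_(p <- ps) _.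
have key tau : 2 * tau * S1 <= S2 + tau ^+ 2 * G.
  apply: (@le_trans _ _ (S2 + tau ^+ 2 * \sum_(p <- ps) g p)); last first.
    by rewrite lerD2l ler_wpM2l ?sqr_ge0.
  rewrite !mulr_sumr -big_split ler_sum// => p _ /=.
  by have := mulr_ge0 (g0 p) (sqr_ge0 (A p - tau)); lra.
have := key (S1 / G).
have -> : S1 ^+ 2 = G * ((S1 / G) * S1) by field; rewrite gt_eqF.
have -> : (S1 / G) ^+ 2 * G = S1 / G * S1 by field; rewrite gt_eqF.
by rewrite ler_pM2l//; lra.
Qed.

Lemma seqcont_powR_gt0 n (b : R) (F : 'rV[R]_n -> R) :
  (forall x, 0 < F x) -> seqcont F -> seqcont (fun x => F x `^ b).
Proof.
move=> F0 sF xs x h; rewrite /powR.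
under eq_fun do rewrite gt_eqF//.
rewrite gt_eqF//; apply: continuous_cvg; first exact: continuous_expR.
apply: cvgMr; apply: continuous_cvg; last exact: sF.
exact: continuous_ln.
Qed.

Lemma peetre n (x l : 'rV[R]_n) : 1 + sqn x <= 2 * (1 + sqn l) * (1 + sqn (x - l)).
Proof.
have := sqn_le x l; have := sqn_ge0 l; have := sqn_ge0 (x - l); nra.
Qed.

(** Peetre's inequality moves the weight from [x] to the centre [l]; half of the Gaussian exponent
    pays for the remaining power of [1 + sqn (x - l)]. *)
Lemma weight_gauss_le n (s : R) : 0 <= s -> s <= n%:R ->
  exists2 C, 0 < C & forall x l : 'rV[R]_n,
    (1 + sqn x) `^ s * expR (- sqn (x - l) / 2) <=
    C * (1 + sqn l) `^ s * expR (- sqn (x - l) / 4).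
Proof.
move=> s0 sn; have [M hM] := @pow_exp_bound R n.
have M0 : 0 < M by apply: lt_le_trans (hM 0 (lexx 0)); rewrite mulr_gt0 ?expR_gt0 ?exprn_gt0 ?addr0.
exists (2 `^ s * (2 ^+ n * M)); first by rewrite !mulr_gt0 ?powR_gt0 ?exprn_gt0.
move=> x l; have l0 := sqn_ge0 l; have y0 := sqn_ge0 (x - l).
set y := sqn (x - l) in y0 *.
have -> : expR (- y / 2) = expR (- (y / 2) / 2) * expR (- y / 4).
  by rewrite -expRD; congr expR; field.
rewrite mulrA ler_wpM2r ?expR_ge0//.
apply: (@le_trans _ _ (2 `^ s * (1 + sqn l) `^ s * (1 + y) `^ s * expR (- (y / 2) / 2))).
  rewrite ler_wpM2r ?expR_ge0// -powRM; [|lra|lra].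
  rewrite -powRM; [|by rewrite mulr_ge0//; lra|lra].
  by apply: ge0_ler_powR; rewrite ?nnegrE//; [have := sqn_ge0 x; lra|nra|exact: peetre].
have h : (1 + y) `^ s * expR (- (y / 2) / 2) <= 2 ^+ n * M.
  apply: (@le_trans _ _ ((2 * (1 + y / 2)) ^+ n * expR (- (y / 2) / 2))).
    rewrite ler_wpM2r ?expR_ge0//.
    apply: (@le_trans _ _ ((1 + y) `^ n%:R)); first by apply: ler_powR => //; lra.
    by rewrite powR_mulrn ?lerXn2r ?nnegrE//; lra.
  by rewrite exprMn -mulrA ler_pM2l ?exprn_gt0// hM//; lra.
rewrite -mulrA [leRHS]mulrAC -mulrA [leLHS]mulrC mulrA.
have := ler_wpM2l (mulr_ge0 (powR_ge0 2 s) (powR_ge0 (1 + sqn l) s)) h; lra.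
Qed.

(** Almost orthogonality: [G] bounds the overlap of the Gaussians, so Cauchy-Schwarz replaces the
    square of the sum by a sum of squares, integrated term by term. [C] is fixed before the packets
    are chosen, and [Q] is the finite squared norm. *)
Lemma Hnorm_le n (s : R) : 0 <= s -> s <= n%:R ->
  exists2 C, 0 < C & forall (P : Type) (ps : seq P) (A B : P -> R)
     (l : P -> 'rV[R]_n) (f : 'rV[R]_n -> R[i]) (G : R),
   (forall xi, fourier f xi =
      Complex (\sum_(p <- ps) A p * expR (- sqn (xi - l p) / 2))
              (\sum_(p <- ps) B p * expR (- sqn (xi - l p) / 2))) ->
   0 < G -> (forall xi, \sum_(p <- ps) expR (- sqn (xi - l p) / 2) <= G) ->
   exists Q, [/\ 0 <= Q, Hnorm s f = (Num.sqrt Q)%:E &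
     Q <= C * G * \sum_(p <- ps) (A p ^+ 2 + B p ^+ 2) * (1 + sqn (l p)) `^ s].
Proof.
move=> s0 sn; have [C1 C10 hC1] := weight_gauss_le s0 sn.
exists (C1 * Num.sqrt (4 * pi) ^+ n).
  by rewrite mulr_gt0// exprn_gt0// sqrtr_gt0 mulr_gt0 ?pi_gt0.
move=> P ps A B l f G fE G0 hG.
pose S (A : P -> R) xi := \sum_(p <- ps) A p * expR (- sqn (xi - l p) / 2).
pose H xi := (1 + sqn xi) `^ s * (S A xi ^+ 2 + S B xi ^+ 2).
pose D xi := \sum_(p <- ps) (G * C1 * ((A p ^+ 2 + B p ^+ 2) * (1 + sqn (l p)) `^ s)) *
   expR (- sqn (xi - l p) / 4).
have H0 xi : 0 <= H xi by rewrite mulr_ge0 ?powR_ge0// addr_ge0 ?sqr_ge0.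
have HE : (fun xi => (((1 + vnorm xi ^+ 2) `^ (s / 2) * cabs (fourier f xi)) ^+ 2)%:E) =
    (fun xi => (H xi)%:E).
  apply/funext => xi; congr EFin; rewrite exprMn fE vnorm_sqr /cabs [complex.Re _]/= [complex.Im _]/= sqr_sqrtr; last first.
    by rewrite addr_ge0 ?sqr_ge0.
  by rewrite -[X in X * _ = _]powR_mulrn ?powR_ge0// -powRrM divfK.
have HD xi : H xi <= D xi.
  have g0 p : 0 <= expR (- sqn (xi - l p) / 2) by exact: expR_ge0.
  have hS := lerD (sqr_sum_le A G0 g0 (hG xi)) (sqr_sum_le B G0 g0 (hG xi)).
  apply: (le_trans (ler_wpM2l (powR_ge0 _ _) hS)).
  rewrite -mulrDr -big_split/= mulrCA mulr_sumr mulr_sumr ler_sum// => p _.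
  rewrite -mulrDl mulrCA.
  have h := ler_wpM2l (addr_ge0 (sqr_ge0 (A p)) (sqr_ge0 (B p))) (hC1 xi (l p)).
  apply: le_trans (le_trans _ (ler_wpM2l (ltW G0) h)) _;
    by rewrite le_eqVlt; apply/orP; left; apply/eqP; ring.
have nD : nice D.
  by apply: nice_sum => p; apply: niceZ; apply: nice_gauss; lra.
have nS (A' : P -> R) : seqcont (S A').
  apply: seqcont_sum => p; apply: seqcontM; first exact: seqcont_cst.
  exact: (@seqcont_subr _ _ (l p) _ (@seqcont_gauss _ n 2)).
have nH : nice H.
  apply: nice_le nD _ => [|xi]; last by rewrite !ger0_norm// (le_trans (H0 xi)).
  apply: seqcontM.
    apply: seqcont_powR_gt0 => [x|]; first by have := sqn_ge0 x; lra.
    by apply: seqcontD; [exact: seqcont_cst|exact: seqcont_sqn].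
  apply: seqcontD; under eq_fun do rewrite expr2; exact: seqcontM.
exists (Rint H); split.
- exact: Rint_ge0.
- by rewrite /Hnorm HE Eint_EFin// poweR_EFin powR12_sqrt// Rint_ge0.
- apply: (le_trans (Rint_le nH nD HD)).
  rewrite Rint_sum; last by move=> p; apply: niceZ; apply: nice_gauss; lra.
  rewrite mulr_sumr ler_sum// => p _.
  rewrite RintZ; last by apply: nice_gauss; lra.
  rewrite Rint_gauss; [|lra|lra].
  by rewrite le_eqVlt; apply/orP; left; apply/eqP; ring.
Qed.

(** * Sums of Gaussians over lattice points *)

Lemma expR1_ge2 : 2 <= expR 1 :> R.
Proof. by have := expR_ge1Dx (1 : R); lra. Qed.

(** Removing the term [m = 0] replaces [y] by [y - 1], and [2 * expR (y - 1) <= expR y] closes the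
    induction. *)
Lemma sum_expN_le0 N (y : R) : y <= 0 -> \sum_(m < N) expR (- `|y - m%:R|) <= 2 * expR y.
Proof.
elim: N y => [y _|N IH y y0]; first by rewrite big_ord0 mulr_ge0 ?expR_ge0.
rewrite big_ord_recl subr0 ler0_norm// opprK.
have -> : \sum_(i < N) expR (- `|y - (lift ord0 i)%:R|) = \sum_(m < N) expR (- `|(y - 1) - m%:R|).
  by apply: eq_bigr => i _; congr (expR (- `|_|)); rewrite /= /bump /= natrD; ring.
have y1 : y - 1 <= 0 by lra.
have := IH _ y1; have e : expR y = expR 1 * expR (y - 1) by rewrite -expRD; congr expR; ring.
have := expR1_ge2; have := expR_ge0 (y - 1); nra.
Qed.

(* The term [- expR (- y)] makes the induction on [N] go through. *)
Lemma sum_expN_ge0 N (y : R) : 0 <= y -> \sum_(m < N) expR (- `|y - m%:R|) <= 4 - expR (- y).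
Proof.
have e1 (z : R) : z <= 0 -> expR z <= 1 by rewrite -(@expR0 R) ler_expR.
elim: N y => [y y0|N IH y y0].
  by rewrite big_ord0; have := e1 (- y); lra.
rewrite big_ord_recl subr0 ger0_norm//.
have -> : \sum_(i < N) expR (- `|y - (lift ord0 i)%:R|) = \sum_(m < N) expR (- `|(y - 1) - m%:R|).
  by apply: eq_bigr => i _; congr (expR (- `|_|)); rewrite /= /bump /= natrD; ring.
have [y1|y1] := leP 1 y.
  have y1' : 0 <= y - 1 by lra.
  have := IH _ y1'; have e : expR (- (y - 1)) = expR 1 * expR (- y) by rewrite -expRD; congr expR; ring.
  have := expR1_ge2; have := expR_ge0 (- y); nra.
have y1' : y - 1 <= 0 by lra.
have := @sum_expN_le0 N _ y1'; have := e1 _ y1'; have := e1 (- y); lra.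
Qed.

(** From [(|z| - 1)^2 >= 0] follows [exp (- z^2 / 2) <= exp (1/2) * exp (- |z|)]; here
    [exp (1/2) <= 2], and the sum of the exponentials is at most 4. *)
Lemma lattice_sum1 N (y : R) : \sum_(m < N) expR (- (y - m%:R) ^+ 2 / 2) <= 8.
Proof.
apply: (@le_trans _ _ (2 * \sum_(m < N) expR (- `|y - m%:R|))).
  rewrite mulr_sumr ler_sum// => m _; set z := y - _.
  have : expR (2^-1) <= 2 :> R.
    rewrite -[leRHS]invrK -[leLHS]invrK -expRN lef_pV2 ?posrE ?expR_gt0 ?invr_gt0//.
    by have := expR_ge1Dx (- 2^-1 : R); lra.
  move=> /(ler_wpM2r (expR_ge0 (- `|z|))); apply: le_trans.
  rewrite -expRD ler_expR -(real_normK (num_real z)).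
  by have := sqr_ge0 (`|z| - 1); lra.
have [y0|y0] := leP 0 y.
  have := sum_expN_ge0 N y0; have := expR_ge0 (- y); lra.
have := sum_expN_le0 N (ltW y0); have : expR y <= 1 by rewrite -(@expR0 R) ler_expR ltW.
lra.
Qed.

(** The lattice points of the cube [(N, 2 N]^n], indexed by functions so that sums of products
    factor over the coordinates. *)
Definition boxv n N (m : {ffun 'I_n -> 'I_N}) : 'rV[R]_n :=
  \row_i (N.+1 + m i)%:R.

(** The ranges [N k < m <= 2 * N k] are disjoint because [2 * N k <= N k.+1], so the double sum
    visits each integer at most once. *)
Lemma lacunary_sum_le (h : nat -> R) (N : nat -> nat) K : (forall m, 0 <= h m) ->
  (forall k, (2 * N k <= N k.+1)%N) ->
  \sum_(k < K) \sum_(j < N k) h ((N k).+1 + j)%N <= \sum_(m < (N K).+1) h m.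
Proof.
move=> h0 hN; elim: K => [|K IH]; first by rewrite big_ord0 sumr_ge0.
rewrite big_ord_recr /=; apply: (@le_trans _ _ (\sum_(m < (N K).+1 + N K) h m)).
  by rewrite big_split_ord /= lerD2r.
have le : ((N K).+1 + N K <= (N K.+1).+1)%N by have := hN K; rewrite mul2n -addnn addSn ltnS.
rewrite -!(big_mkord xpredT h) (big_cat_nat _ le)//= lerDl.
exact: sumr_ge0.
Qed.

(** The sum over a cube factors over the coordinates. Every factor but the first is at most 8, and
    the first ones run over disjoint ranges at different levels, so the sum over the levels does not
    depend on their number. *)
Lemma lattice_sum n (N : nat -> nat) K (xi : 'rV[R]_n.+1) :
  (forall k, (2 * N k <= N k.+1)%N) ->
  \sum_(k < K) \sum_(m : {ffun 'I_n.+1 -> 'I_(N k)}) expR (- sqn (xi - boxv m) / 2) <= 8 ^+ n.+1.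
Proof.
move=> hN; pose h i m : R := expR (- (xi 0 i - m%:R) ^+ 2 / 2).
have h0 i m : 0 <= h i m by exact: expR_ge0.
have E k : \sum_(m : {ffun 'I_n.+1 -> 'I_(N k)}) expR (- sqn (xi - boxv m) / 2) =
    \prod_i \sum_(j < N k) h i ((N k).+1 + j)%N.
  rewrite bigA_distr_bigA /=; apply: eq_bigr => m _.
  rewrite -expR_sum; congr expR; rewrite /sqn -sumrN mulr_suml.
  by apply: eq_bigr => i _; rewrite !mxE.
under eq_bigr do rewrite E.
have h8 i k : \sum_(j < N k) h i ((N k).+1 + j)%N <= 8.
  apply: le_trans (lattice_sum1 (N k) (xi 0 i - (N k).+1%:R)).
  by rewrite ler_sum// => j _; rewrite /h natrD opprD addrA.
apply: (@le_trans _ _ (\sum_(k < K) (\sum_(j < N k) h ord0 ((N k).+1 + j)%N) * 8 ^+ n)).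
  apply: ler_sum => k _; rewrite big_ord_recl ler_wpM2l ?sumr_ge0//.
  rewrite -[8 ^+ n](_ : \prod_(i < n) (8 : R) = _); last by rewrite prodr_const card_ord.
  by apply: ler_prod => i _; rewrite sumr_ge0 ?h8.
rewrite -mulr_suml exprS ler_wpM2r ?exprn_ge0//.
by apply: (le_trans (lacunary_sum_le K (h0 ord0) hN)); exact: lattice_sum1.
Qed.

End SobolevNorm.

(** * Random signs *)

Section RandomSigns.
Local Open Scope classical_set_scope.
Context {R : realType}.
Variables (b K : nat).
Hypothesis b0 : (0 < b)%N.

Let Omega : finType := {ffun 'I_K.+1 * 'I_(b ^ K).+1 -> bool}.

(* Levels [k < K] and blocks [I < b ^ k] are natural numbers; [inord] is only meaningful
   in these ranges. *)
Definition sgn (w : Omega) (k I : nat) : R := (-1) ^+ w (inord k, inord I).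

Definition flip (k I : nat) (w : Omega) : Omega :=
  [ffun p => w p (+) (p == (inord k, inord I))].

Lemma flipK k I : involutive (flip k I).
Proof. by move=> w; apply/ffunP => p; rewrite !ffunE -addbA addbb addbF. Qed.

Lemma sgn_flip k I w : sgn (flip k I w) k I = - sgn w k I.
Proof. by rewrite /sgn ffunE eqxx addbT; case: (w _); rewrite /= ?expr1 ?expr0 ?opprK. Qed.

Lemma sgn_flip_neq k I k' I' w : (k <= K)%N -> (I <= b ^ K)%N -> (k' <= K)%N -> (I' <= b ^ K)%N ->
  (k' != k) || (I' != I) -> sgn (flip k I w) k' I' = sgn w k' I'.
Proof.
move=> hk hI hk' hI' h; rewrite /sgn ffunE.
suff -> : (inord k' : 'I_K.+1, inord I' : 'I_(b ^ K).+1) == (inord k, inord I) = false by rewrite addbF.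
apply/negbTE; apply: contraTN h => /eqP[/(congr1 val) e1 /(congr1 val) e2].
by rewrite /= !inordK// in e1 e2; rewrite e1 e2 !eqxx.
Qed.

Lemma sgn_sqr w k I : sgn w k I * sgn w k I = 1.
Proof. by rewrite /sgn -expr2 sqrr_sign. Qed.

Lemma norm_sgn w k I : `|sgn w k I| = 1.
Proof. by rewrite /sgn normr_sign. Qed.

Lemma sum_flip k I (F : Omega -> R) : \sum_w F (flip k I w) = \sum_w F w.
Proof. by rewrite [RHS](reindex_inj (inv_inj (@flipK k I))). Qed.

(** Flipping one sign permutes the sample space; this symmetry replaces independence and mean
    zero. *)
Lemma sum_flip_odd k I (F : Omega -> R) : (forall w, F (flip k I w) = - F w) ->
  \sum_w F w = 0.
Proof.
move=> h; have := sum_flip k I F; under eq_bigr do rewrite h.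
by rewrite sumrN => e; lra.
Qed.

Lemma pow_b_gt0 k : (0 < b ^ k)%N. Proof. by rewrite expn_gt0 b0. Qed.

Lemma divn_lt k j : (k <= K)%N -> (j < b ^ K)%N -> (j %/ b ^ (K - k) < b ^ k)%N.
Proof. by move=> hk hj; rewrite ltn_divLR ?pow_b_gt0// -expnD subnKC. Qed.

Lemma block_lt k I : (k <= K)%N -> (I < b ^ k)%N -> (I <= b ^ K)%N.
Proof.
move=> hk /ltnW hI; apply: leq_trans hI _.
by move: b0 hk; case: (b) => // b' _ hk; rewrite leq_pexp2l.
Qed.

(** * The random path and its decomposition by level *)

Variable lam : nat -> R.

(** [j] numbers the [b ^ K] finest time blocks, and [j %/ b ^ (K - k)] is the level-[k] block that
    contains block [j]. *)
Definition sgn_path (w : Omega) (j : nat) : R :=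
  \sum_(k < K) lam k * sgn w k (j %/ b ^ (K - k)).

(** The levels below [k] are constant on a block [I] of level [k], so this part of the path may
    enter the phase of a packet of that block. *)
Definition coarse (w : Omega) (k I : nat) : R :=
  \sum_(k' < k) lam k' * sgn w k' (I %/ b ^ (k - k')).

Definition finer (w : Omega) (k j : nat) : R :=
  \sum_(k.+1 <= k' < K) lam k' * sgn w k' (j %/ b ^ (K - k')).

Lemma path_split w k j : (k < K)%N ->
  sgn_path w j = coarse w k (j %/ b ^ (K - k)) + lam k * sgn w k (j %/ b ^ (K - k)) + finer w k j.
Proof.
move=> hk; rewrite /sgn_path -(big_mkord xpredT (fun k => lam k * sgn w k (j %/ b ^ (K - k)))).
rewrite (big_cat_nat (leq0n k.+1))//= big_nat_recr//=; congr (_ + _ + _).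
rewrite big_mkord; apply: eq_bigr => k' _; congr (_ * sgn _ _ _).
rewrite -divnMA -expnD; congr (_ %/ b ^ _)%N.
by have := ltn_ord k'; lia.
Qed.

Lemma coarse_flip w k I I' : (k <= K)%N -> (I < b ^ k)%N -> (I' < b ^ k)%N ->
  coarse (flip k I w) k I' = coarse w k I'.
Proof.
move=> hk hI hI'; apply: eq_bigr => k' _; rewrite sgn_flip_neq//.
- exact: block_lt hI.
- by apply: leq_trans hk; exact/ltnW/ltn_ord.
- by apply: leq_trans (leq_div _ _) _; exact: block_lt hI'.
- by rewrite ltn_eqF.
Qed.

Lemma finer_flip w k I j : (k <= K)%N -> (I < b ^ k)%N -> (j < b ^ K)%N ->
  finer (flip k I w) k j = finer w k j.
Proof.
move=> hk hI hj; rewrite /finer !big_nat; apply: eq_bigr => k' /andP[h1 h2].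
rewrite sgn_flip_neq//; [exact: block_lt hI|exact: ltnW| |by rewrite gtn_eqF].
by apply: leq_trans (leq_div _ _) _; exact: ltnW.
Qed.

Lemma path_flip w k I j : (k < K)%N -> (I < b ^ k)%N -> (j < b ^ K)%N ->
  I != (j %/ b ^ (K - k))%N -> sgn_path (flip k I w) j = sgn_path w j.
Proof.
move=> hk hI hj hne; have hk' := ltnW hk.
have hd := divn_lt hk' hj.
rewrite !(path_split _ _ hk) coarse_flip// finer_flip// sgn_flip_neq//.
- exact: block_lt hI.
- exact: block_lt hd.
- by rewrite eq_sym hne orbT.
Qed.

Hypothesis lam_ge0 : forall k, 0 <= lam k.

Lemma norm_path w j : `|sgn_path w j| <= \sum_(k < K) lam k.
Proof.
apply: le_trans (ler_norm_sum _ _ _) _; apply: ler_sum => k _.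
by rewrite normrM norm_sgn mulr1 ger0_norm.
Qed.

Lemma norm_finer w k j : `|finer w k j| <= \sum_(k.+1 <= k' < K) lam k'.
Proof.
apply: le_trans (ler_norm_sum _ _ _) _; apply: ler_sum => k' _.
by rewrite normrM norm_sgn mulr1 ger0_norm.
Qed.

(** This cancels the phase of the coarse path and the time phase [theta I]; the quarter turn
    converts the cosine into a sine, which is odd in the displacement. *)
Definition phase (w : Omega) (sigma : R) (theta : nat -> R) (k I : nat) : R :=
  - (sigma * coarse w k I + theta I) - pi / 2.

Lemma phase_flip w sigma theta k I I' : (k <= K)%N -> (I < b ^ k)%N -> (I' < b ^ k)%N ->
  phase (flip k I w) sigma theta k I' = phase w sigma theta k I'.
Proof. by move=> *; rewrite /phase coarse_flip. Qed.

(* All terms with [I] different from the block of [j] are odd under a flip; in the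
   remaining one, averaging over the flip gives
   s sin (s alpha + beta) -> sin alpha * cos beta. *)
Lemma sum_focus (W : R -> R -> R) (sigma tau : R) (theta : nat -> R) (delta : R) (k j : nat) :
  (k < K)%N -> (j < b ^ K)%N ->
  2^-1 <= sigma * lam k <= 1 ->
  `|tau - theta (j %/ b ^ (K - k))%N| <= 2^-1 ->
  `|sigma| * \sum_(k.+1 <= k' < K) lam k' <= 2^-1 ->
  (forall y c, `|y| <= \sum_(k < K) lam k -> `|W y c - cos (sigma * y + tau + c)| <= delta) ->
  #|Omega|%:R * (8^-1 - delta) <=
  \sum_w \sum_(I < b ^ k) sgn w k I * W (sgn_path w j) (phase w sigma theta k I).
Proof.
move=> hk hj hal hth hfi hW; have hk' := ltnW hk.
have hI0 := divn_lt hk' hj; set I0 := Ordinal hI0.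
rewrite exchange_big (bigD1 I0)//= [X in _ <= _ + X]big1 ?addr0; last first.
  move=> I hI; apply: (@sum_flip_odd k I) => w.
  by rewrite sgn_flip path_flip// phase_flip// mulNr.
pose F w := sgn w k I0 * W (sgn_path w j) (phase w sigma theta k I0).
change (#|Omega|%:R * (8^-1 - delta) <= \sum_w F w).
(* In a pair of [w] and its flip both signs of block [I0] occur, so the pair yields
   [2 sin alpha cos beta >= 2 * 4^-1 * 2^-1] up to two approximation errors. *)
suff : forall w, 4^-1 - 2 * delta <= F w + F (flip k I0 w).
  move=> h; have : \sum_(w : Omega) (4^-1 - 2 * delta) <= \sum_w F w + \sum_w F w.
    rewrite -[X in _ <= _ + X](sum_flip k I0) -big_split; apply: ler_sum => w _ /=; exact: h.
  by rewrite sumr_const -[_ *+ _]mulr_natl; lra.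
move=> w.
pose beta := sigma * finer w k j + (tau - theta I0).
have cb : 2^-1 <= cos beta.
  apply: cos_ge_half; apply: le_trans (ler_normD _ _) _; rewrite normrM.
  have := ler_wpM2l (normr_ge0 sigma) (norm_finer w k j); move: hth hfi; rewrite /=; lra.
have sa := sin_ge_quarter hal.
have main v : coarse v k I0 = coarse w k I0 -> finer v k j = finer w k j ->
    sgn v k I0 * sin (sgn v k I0 * (sigma * lam k) + beta) - delta <= F v.
  move=> ec ef; have := hW _ (phase v sigma theta k I0) (norm_path v j).
  have -> : sigma * sgn_path v j + tau + phase v sigma theta k I0 =
     (sgn v k I0 * (sigma * lam k) + beta) - pi / 2.
    by rewrite (path_split _ _ hk) /phase /beta -/(nat_of_ord I0) ec ef /=; ring.
  rewrite cosBpihalf /F -/(nat_of_ord I0).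
  have := sgn_sqr v k I0; have := norm_sgn v k I0.
  set s := sgn _ _ _; set X := sin _; set V := W _ _.
  move=> s1 s2 hV; have : `|s * V - s * X| <= delta by rewrite -mulrBr normrM s1 mul1r.
  by rewrite ler_distl => /andP[]; rewrite lerBlDr; lra.
have h1 := main w erefl erefl.
have h2 := main (flip k I0 w) (coarse_flip _ hk' hI0 hI0) (finer_flip _ hk' hI0 hj).
clearbody beta; apply: le_trans (lerD h1 h2); rewrite sgn_flip !sinD !mulNr sinN cosN.
have [-> | ->] : sgn w k I0 = 1 \/ sgn w k I0 = -1.
  by rewrite /sgn; case: (w _); [right; rewrite expr1|left; rewrite expr0].
- by rewrite !mul1r; nra.
- by rewrite !mulN1r ?opprK sinN cosN; nra.
Qed.

(** Orthogonality of the signs: [g] does not see the signs of level [k], so an off-diagonal term is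
    odd under the flip of one of its two signs. *)
Lemma sum_sqr_signs (g : Omega -> nat -> R) k : (k <= K)%N ->
  (forall w I I', (I < b ^ k)%N -> (I' < b ^ k)%N -> g (flip k I w) I' = g w I') ->
  \sum_w (\sum_(I < b ^ k) sgn w k I * g w I) ^+ 2 = \sum_w \sum_(I < b ^ k) g w I ^+ 2.
Proof.
move=> hk hg.
under eq_bigr do rewrite expr2 mulr_suml; under eq_bigr do under eq_bigr do rewrite mulr_sumr.
rewrite exchange_big [RHS]exchange_big /=; apply: eq_bigr => I _.
rewrite exchange_big (bigD1 I)//= [X in _ + X]big1 ?addr0.
  by apply: eq_bigr => w _; rewrite mulrACA sgn_sqr mul1r expr2.
move=> J hJ; apply: (@sum_flip_odd k I) => w.
rewrite sgn_flip (@sgn_flip_neq k I k J)//; last 1 first.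
- by apply/orP; right; apply: contraNneq hJ => e; apply/eqP/val_inj.
- by rewrite !hg//; ring.
- exact: block_lt (ltn_ord I).
- exact: block_lt (ltn_ord J).
Qed.

Lemma sum_phase_sqr sigma theta k : (k <= K)%N ->
  \sum_w ((\sum_(I < b ^ k) sgn w k I * cos (phase w sigma theta k I)) ^+ 2 +
          (\sum_(I < b ^ k) sgn w k I * sin (phase w sigma theta k I)) ^+ 2) =
  #|Omega|%:R * (b ^ k)%:R.
Proof.
move=> hk; rewrite big_split /=.
rewrite (@sum_sqr_signs (fun w I => cos (phase w sigma theta k I)))//; last first.
  by move=> w I I' hI hI'; rewrite phase_flip.
rewrite (@sum_sqr_signs (fun w I => sin (phase w sigma theta k I)))//; last first.
  by move=> w I I' hI hI'; rewrite phase_flip.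
rewrite -big_split /=; under eq_bigr do rewrite -big_split /=.
under eq_bigr do under eq_bigr do rewrite cos2Dsin2.
by rewrite sumr_const sumr_const card_ord -mulrnA -natrM mulnC.
Qed.

End RandomSigns.

(** * Choice of the scales *)

Section Scales.
Local Open Scope classical_set_scope.
Context {R : realType}.
Local Notation mu := (@lebesgue_measure R).

(* [N k] is the integer part of (z^2 36^k)^(1/a), where T = cc / z^2 and z is large. *)
Lemma scales_exist (a cc delta : R) (K : nat) : 0 < a -> a <= 2 -> 0 < cc -> 0 < delta ->
  exists (T : R) (N : nat -> nat), [/\ 0 < T, (forall k, 0 < N k)%N,
    (forall k, 3 * N k <= N k.+1)%N,
    (forall k, T * (N k)%:R `^ a <= cc * (36 ^ k)%:R) &
    [/\ forall k, cc * (36 ^ k)%:R <= 4 * T * (N k)%:R `^ a,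
      (N 0%N)%:R^-1 <= delta &
      forall k, (k <= K)%N -> T * (N k)%:R `^ (a / 2) <= delta]].
Proof.
move=> a0 a2 c0 d0.
have ai0 : 0 < a^-1 by rewrite invr_gt0.
have ai2 : 2^-1 <= a^-1 by rewrite lef_pV2 ?posrE.
(* The first two summands force [N 0 >= delta^-1]; the last one gives [T * N k ^ (a / 2) <= cc * 6 ^
   K / z <= delta] for [k <= K]. *)
pose z := 2 + delta^-1 + cc * 6 ^+ K / delta.
have di : 0 < delta^-1 by rewrite invr_gt0.
have ci : 0 <= cc * 6 ^+ K / delta by rewrite !mulr_ge0 ?exprn_ge0 ?ltW.
have z1 : 1 <= z by rewrite /z; lra.
have z0 : 0 < z by lra.
have zp := ltW z0.
have hz1 : 2 + delta^-1 <= z by rewrite /z; lra.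
have hz2 : cc * 6 ^+ K / delta <= z by rewrite /z; lra.
clearbody z.
pose y k : R := (z ^+ 2 * (36 ^ k)%:R) `^ a^-1.
have p36 k : 1 <= (36 ^ k)%:R :> R by rewrite ler1n expn_gt0.
have zz : 1 <= z ^+ 2 by rewrite expr_ge1.
have q0 k : 1 <= z ^+ 2 * (36 ^ k)%:R by have := p36 k; nra.
have y0 k : 0 <= y k by exact: powR_ge0.
have ya k : y k `^ a = z ^+ 2 * (36 ^ k)%:R.
  by rewrite -powRrM mulVf ?gt_eqF// powRr1// (le_trans ler01).
(* Since [a <= 2], consecutive scales grow by a factor of at least 6; truncation to integers still
   leaves the factor 3. *)
have sqrt36 : 6 <= 36 `^ a^-1 :> R.
  apply: (@le_trans _ _ (36 `^ 2^-1)).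
    by rewrite powR12_sqrt// (_ : 36 = 6 ^+ 2) ?sqrtr_sqr ?ger0_norm//; ring.
  by apply: ler_powR => //; lra.
have yS k : 6 * y k <= y k.+1.
  rewrite /y expnS natrM mulrCA (@powRM _ 36) ?mulr_ge0 ?ler0n ?sqr_ge0 ?(ltW z0)//.
  by rewrite ler_wpM2r ?powR_ge0.
have yz k : z <= y k.
  apply: (@le_trans _ _ ((z ^+ 2) `^ 2^-1)).
    by rewrite powR12_sqrt ?sqr_ge0// sqrtr_sqr ger0_norm.
  apply: (@le_trans _ _ ((z ^+ 2 * (36 ^ k)%:R) `^ 2^-1)); last exact: ler_powR.
  apply: ge0_ler_powR; rewrite ?nnegrE ?sqr_ge0 ?invr_ge0//.
    by rewrite mulr_ge0 ?sqr_ge0.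
  by have := p36 k; nra.
pose N k := Num.truncn (y k).
have Nle k : (N k)%:R <= y k by rewrite truncn_le.
have Nlt k : y k < (N k)%:R + 1 by rewrite natr1 truncnS_gt.
have N0 k : (0 < N k)%N by rewrite truncn_gt0 (le_trans z1).
have N1 k : 1 <= (N k)%:R :> R by rewrite ler1n.
have Na k : (N k)%:R `^ a <= z ^+ 2 * (36 ^ k)%:R.
  by rewrite -ya; apply: ge0_ler_powR; rewrite ?nnegrE ?y0 ?ler0n ?(ltW a0).
exists (cc / z ^+ 2), N; split=> //.
- by rewrite divr_gt0 ?exprn_gt0.
- move=> k; rewrite -(ler_nat R) natrM.
  have := Nle k; have := Nlt k.+1; have := yS k; have := N1 k; have := z1; lra.
- move=> k; rewrite -mulrA ler_pM2l// mulrC ler_pdivrMr ?exprn_gt0// mulrC.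
  exact: Na.
split.
- move=> k.
  have -> : 4 * (cc / z ^+ 2) * (N k)%:R `^ a = cc * (4 * (N k)%:R `^ a / z ^+ 2).
    by field; rewrite gt_eqF.
  rewrite ler_pM2l// ler_pdivlMr ?exprn_gt0// mulrC -ya.
  (* Truncation loses at most a factor 2, hence at most [2 ^ a <= 4] after taking the power. *)
  apply: (@le_trans _ _ ((2 * (N k)%:R) `^ a)).
    apply: ge0_ler_powR; rewrite ?nnegrE ?mulr_ge0 ?y0 ?ler0n ?(ltW a0)//.
    by apply/ltW; apply: lt_le_trans (Nlt k) _; have := N1 k; lra.
  rewrite powRM// ler_wpM2r ?powR_ge0//.
  apply: (@le_trans _ _ (2 `^ 2)); first by apply: ler_powR => //; lra.
  by rewrite powR_mulrn// expr2; lra.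
- rewrite -[leRHS]invrK lef_pV2 ?posrE//; last by rewrite ltr0n.
  have := Nlt 0%N; have := yz 0%N; lra.
- move=> k kK.
  have h : (N k)%:R `^ (a / 2) <= z * 6 ^+ K.
    rewrite powRrM; apply: (@le_trans _ _ ((z ^+ 2 * (36 ^ K)%:R) `^ 2^-1)).
      apply: ge0_ler_powR; rewrite ?nnegrE ?powR_ge0 ?mulr_ge0 ?sqr_ge0 ?invr_ge0//.
      by apply: (le_trans (Na k)); rewrite ler_wpM2l ?sqr_ge0// ler_nat leq_pexp2l.
    rewrite natrX (_ : 36 = 6 ^+ 2); last by ring.
    by rewrite -exprM mulnC exprM -exprMn powR12_sqrt ?sqr_ge0// sqrtr_sqr ger0_norm// mulr_ge0 ?exprn_ge0.
  apply: (@le_trans _ _ (cc / z ^+ 2 * (z * 6 ^+ K))).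
    by rewrite ler_wpM2l// divr_ge0 ?sqr_ge0// ltW.
  have -> : cc / z ^+ 2 * (z * 6 ^+ K) = cc * 6 ^+ K / z by field; rewrite gt_eqF.
  by rewrite ler_pdivrMr// (mulrC delta) -ler_pdivrMr.
Qed.

(** Comparison with a geometric series of ratio 1/3, by induction on the number of terms. *)
Lemma tail_sum_le (u : nat -> R) K k : (forall k, 0 <= u k) -> (forall k, 3 * u k.+1 <= u k) ->
  \sum_(k.+1 <= k' < K) u k' <= u k / 2.
Proof.
move=> u0 hu; have [n] := ubnP (K - k)%N; elim: n k => // n IH k hn.
have [hk|hk] := leqP K k.+1; first by rewrite big_geq// divr_ge0.
rewrite big_ltn//; have : (K - k.+1 < n)%N by lia.
by move=> /IH; have := hu k; have := u0 k.+1; lra.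
Qed.

(** * Size and phase variation of the frequencies in one cube *)

Section Box.
Variables (n N : nat).
Hypotheses (n0 : (0 < n)%N) (N0 : (0 < N)%N).
Variable m : {ffun 'I_n -> 'I_N}.
Let l : 'rV[R]_n := boxv m.

Let N1 : 1 <= N%:R :> R. Proof. by rewrite ler1n. Qed.
Let n1 : 1 <= n%:R :> R. Proof. by rewrite ler1n. Qed.

Lemma boxv_coord i : N%:R <= l 0 i <= 2 * N%:R.
Proof.
rewrite mxE -natrM !ler_nat; have := ltn_ord (m i); lia.
Qed.

Lemma boxv_sum : n%:R * N%:R <= \sum_i l 0 i <= 2 * n%:R * N%:R.
Proof.
have e (c : R) : \sum_(i < n) c = n%:R * c by rewrite sumr_const card_ord mulr_natl.
rewrite mulrAC -[2 * _ * _]mulrC -!e; apply/andP; split; apply: ler_sum => i _.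
  by have /andP[] := boxv_coord i.
by have /andP[_] := boxv_coord i.
Qed.

Lemma boxv_sqn : sqn l <= 4 * n%:R * N%:R ^+ 2.
Proof.
have -> : 4 * n%:R * N%:R ^+ 2 = \sum_(i < n) (4 * N%:R ^+ 2) :> R.
  by rewrite sumr_const card_ord -[RHS]mulr_natl; ring.
by apply: ler_sum => i _; have /andP[] := boxv_coord i; nra.
Qed.

Lemma boxv_vnorm_powR (a : R) : 0 < a -> a <= 2 -> vnorm l `^ a <= 4 * n%:R * N%:R `^ a.
Proof.
move=> a0 a2; rewrite vnorm_powR.
have h : 0 <= a / 2 by rewrite divr_ge0// ltW.
apply: (@le_trans _ _ ((4 * n%:R * N%:R ^+ 2) `^ (a / 2))).
  apply: ge0_ler_powR => //; last exact: boxv_sqn.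
    by rewrite nnegrE sqn_ge0.
  by rewrite nnegrE !mulr_ge0 ?sqr_ge0 ?ler0n.
rewrite powRM ?mulr_ge0 ?exprn_ge0 ?ler0n//.
have -> : (N%:R ^+ 2) `^ (a / 2) = N%:R `^ a :> R.
  by rewrite -(@powR_mulrn _ N%:R 2) ?ler0n// -powRrM mulrCA divff ?mulr1 ?pnatr_eq0.
rewrite ler_wpM2r ?powR_ge0//; apply: ler1_powR; first by have := n1; lra.
by rewrite ler_pdivrMr// mul1r.
Qed.

Lemma boxv_weight (s : R) : 0 <= s -> s <= n%:R ->
  (1 + sqn l) `^ s <= (5 * n%:R) ^+ n * N%:R `^ (2 * s).
Proof.
move=> s0 sn.
apply: (@le_trans _ _ ((5 * n%:R * N%:R ^+ 2) `^ s)).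
  apply: ge0_ler_powR; rewrite ?nnegrE ?addr_ge0 ?sqn_ge0 ?mulr_ge0 ?exprn_ge0 ?ler0n//.
  have := boxv_sqn; have : 1 <= n%:R * N%:R ^+ 2 :> R by rewrite mulr_ege1 ?expr_ge1 ?ler0n.
  lra.
rewrite powRM ?mulr_ge0 ?exprn_ge0 ?ler0n//.
have -> : (N%:R ^+ 2) `^ s = N%:R `^ (2 * s) :> R.
  by rewrite -(@powR_mulrn _ N%:R 2) ?ler0n// -powRrM.
rewrite ler_wpM2r ?powR_ge0//.
apply: (@le_trans _ _ ((5 * n%:R) `^ n%:R)); first by apply: ler_powR => //; have := n1; lra.
by rewrite powR_mulrn// mulr_ge0.
Qed.

Lemma sum_norm_le (eta : 'rV[R]_n) : \sum_i `|eta 0 i| <= n%:R * (1 + sqn eta).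
Proof.
apply: (@le_trans _ _ (\sum_(i < n) (1 + eta 0 i ^+ 2))).
  by apply: ler_sum => i _; rewrite -(real_normK (num_real (eta 0 i))); have := normr_ge0 (eta 0 i); nra.
rewrite big_split sumr_const card_ord /= -/(sqn eta).
by have := sqn_ge0 eta; have := n1; nra.
Qed.

(** This supplies the hypothesis of [wave_approx]. Shifting the frequency by [eta] changes its
    squared norm by at most [5 n N (1 + sqn eta)]; [powR_holder] turns this into a multiple of
    [N ^ (a / 2)], which is small after multiplication by [t]. *)
Lemma boxv_phase (a t y delta : R) (eta : 'rV[R]_n) : 0 < a -> a <= 2 ->
  0 <= t -> t * N%:R `^ (a / 2) <= delta -> n%:R * `|y| <= delta ->
  `|vdot (const_mx y) eta + t * (vnorm (l + eta) `^ a - vnorm l `^ a)| <=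
  (delta * (1 + 5 * n%:R)) * (1 + sqn eta).
Proof.
move=> a0 a2 t0 ht hy.
have e0 := sqn_ge0 eta; have hs := sum_norm_le eta.
have h1 : `|vdot (const_mx y) eta| <= delta * (1 + sqn eta).
  rewrite /vdot; under eq_bigr do rewrite mxE.
  rewrite -mulr_sumr normrM; apply: (@le_trans _ _ (`|y| * (n%:R * (1 + sqn eta)))).
    by rewrite ler_wpM2l// (le_trans (ler_norm_sum _ _ _)).
  by rewrite mulrA (mulrC `|y|) ler_wpM2r// addr_ge0.
have h2 : `|sqn (l + eta) - sqn l| <= 5 * n%:R * N%:R * (1 + sqn eta).
  have -> : sqn (l + eta) - sqn l = \sum_i (2 * l 0 i * eta 0 i) + sqn eta.
    by rewrite /sqn -sumrB -big_split; apply: eq_bigr => i _; rewrite !mxE /=; ring.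
  apply: (le_trans (ler_normD _ _)); rewrite (ger0_norm e0).
  apply: (@le_trans _ _ (4 * N%:R * (\sum_i `|eta 0 i|) + sqn eta)).
    rewrite lerD2r mulr_sumr (le_trans (ler_norm_sum _ _ _))// ler_sum// => i _.
    rewrite normrM ler_wpM2r// ger0_norm; have /andP[] := boxv_coord i; lra.
  have := N1; have := n1.
  have : 4 * N%:R * (\sum_i `|eta 0 i|) <= 4 * N%:R * (n%:R * (1 + sqn eta)).
    by rewrite ler_wpM2l// mulr_ge0.
  have : (1 + sqn eta) <= n%:R * N%:R * (1 + sqn eta).
    by rewrite ler_peMl ?addr_ge0// mulr_ege1.
  lra.
have b0 : 0 < a / 2 by rewrite divr_gt0.
have b1 : a / 2 <= 1 by rewrite ler_pdivrMr// mul1r.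
have h3 : `|vnorm (l + eta) `^ a - vnorm l `^ a| <= 5 * n%:R * N%:R `^ (a / 2) * (1 + sqn eta).
  rewrite !vnorm_powR; apply: (le_trans (powR_holder b0 b1 (sqn_ge0 _) (sqn_ge0 _))).
  apply: (@le_trans _ _ ((5 * n%:R * N%:R * (1 + sqn eta)) `^ (a / 2))).
    by apply: ge0_ler_powR; rewrite ?nnegrE ?mulr_ge0 ?addr_ge0 ?ler0n// ltW.
  rewrite !powRM ?mulr_ge0 ?addr_ge0 ?ler0n//.
  have n5 : (5 * n%:R) `^ (a / 2) <= 5 * n%:R :> R.
    by apply: ler1_powR => //; have := n1; lra.
  rewrite powRM ?ler0n// in n5.
  apply: ler_pM; rewrite ?mulr_ge0 ?powR_ge0//.
    by rewrite ler_wpM2r ?powR_ge0.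
  by apply: ler1_powR => //; rewrite lerDl.
apply: (le_trans (ler_normD _ _)); 
rewrite (_ : delta * (1 + 5 * n%:R) * (1 + sqn eta) =
  delta * (1 + sqn eta) + delta * (5 * n%:R) * (1 + sqn eta)); last by ring.
rewrite lerD// normrM ger0_norm//.
apply: (le_trans (ler_wpM2l t0 h3)).
rewrite (_ : t * _ = t * N%:R `^ (a / 2) * (5 * n%:R) * (1 + sqn eta)); last by ring.
by rewrite ler_wpM2r ?addr_ge0// ler_wpM2r// mulr_ge0.
Qed.

End Box.
End Scales.

(** * Integration in time *)

Section TimeIntegral.
Local Open Scope classical_set_scope.
Context {R : realType}.
Local Notation mu := (@lebesgue_measure R).

(* [g] need not be measurable (unlike in [ge0_le_integral]): it will be a supremum over
   space, whose measurability in time is not known. *)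
Lemma le_ge0_integral d (S : measurableType d) (nu : {measure set S -> \bar R})
    (f g : S -> \bar R) : (forall x, 0 <= f x)%E -> (forall x, f x <= g x)%E ->
  (\int[nu]_x f x <= \int[nu]_x g x)%E.
Proof.
move=> f0 fg; have g0 x : (0 <= g x)%E by apply: le_trans (fg x).
rewrite !ge0_integralTE//; apply: le_ereal_sup => _ [h hf <-]; exists h => // x.
exact: le_trans (hf x) (fg x).
Qed.

(** The supremum over space dominates the value at one point, which may depend on [t]: a lower bound
    along a path thus passes to the mixed norm. *)
Lemma integral_le_of_L2tLinfx (a : R) n (f : 'rV[R]_n -> R[i]) (h : R -> R) (c : R) :
  (forall t, 0 <= h t) ->
  (forall t, exists x, h t <= cabs (prop_op a t f x) ^+ 2) ->
  (L2tLinfx a f <= c%:E)%E -> (\int[mu]_t (h t)%:E <= (c ^+ 2)%:E)%E.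
Proof.
move=> h0 hx hc.
apply: (@le_trans _ _ (\int[mu]_t (`|Linf_x (prop_op a t f)| `^ 2))%E).
  apply: le_ge0_integral => t; first by rewrite lee_fin.
  have [x hxt] := hx t.
  apply: (@le_trans _ _ (((cabs (prop_op a t f x))%:E) `^ 2)%E).
    rewrite poweR_EFin lee_fin powR_mulrn// ?sqrtr_ge0//.
  apply: gt0_ler_poweR; rewrite ?in_itv/= ?leey ?andbT ?abse_ge0 ?lee_fin ?sqrtr_ge0//.
  apply: le_trans (lee_abs _); apply: ereal_sup_ubound; by exists x.
move: hc; rewrite /L2tLinfx unlock; set X := (\int[mu]_x _)%E.
have X0 : (0 <= X)%E by apply: integral_ge0 => t _; exact: poweR_ge0.
move=> hc; have c0 : 0 <= c by rewrite -lee_fin; apply: le_trans hc; exact: poweR_ge0.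
have -> : X = ((X `^ 2^-1) `^ 2)%E by rewrite -poweRrM mulVf ?pnatr_eq0// poweRe1.
have -> : (c ^+ 2)%:E = (c%:E `^ 2)%E by rewrite poweR_EFin powR_mulrn.
by apply: gt0_ler_poweR => //; rewrite ?in_itv/= ?leey ?andbT ?lee_fin ?poweR_ge0.
Qed.

(** * Division of the time interval into equal half-open blocks *)

Section Blocks.
Variables (T : R) (M : nat).
Hypotheses (T0 : 0 < T) (M0 : (0 < M)%N).

Definition block (j : nat) : set R := `[j%:R * (T / M%:R), j.+1%:R * (T / M%:R)[.

Let e0 : 0 < T / M%:R. Proof. by rewrite divr_gt0// ltr0n. Qed.

Lemma blockP t j : 0 <= t -> block j t <-> j = Num.truncn (t / (T / M%:R)).
Proof.
move=> t0; rewrite /block /= in_itv /=; split=> [/andP[h1 h2]|->].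
  by apply/esym/truncn_def; rewrite ler_pdivlMr// ltr_pdivrMr// h1.
by rewrite -ler_pdivlMr// -ltr_pdivrMr// truncn_itv// divr_ge0// ltW.
Qed.

Lemma block_ge0 t j : block j t -> 0 <= t.
Proof. by rewrite /block /= in_itv /= => /andP[h _]; apply: le_trans h; rewrite mulr_ge0 ?ler0n ?(ltW e0). Qed.

Lemma block_index_lt t : 0 <= t -> t < T -> (Num.truncn (t / (T / M%:R)) < M)%N.
Proof.
move=> t0 tT; have h : 0 <= t / (T / M%:R) by rewrite divr_ge0// ltW.
rewrite truncn_lt_nat// ltr_pdivrMr//.
by rewrite mulrCA divff ?mulr1// pnatr_eq0 -lt0n.
Qed.

(** The path jumps between blocks, so quantities along it are continuous only on each block; the
    indicators keep them measurable. *)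
Definition blockwise (g : nat -> R -> R) (t : R) : R :=
  \sum_(j < M) \1_(block j) t * g j t.

Lemma blockwiseE g t j : (j < M)%N -> block j t -> blockwise g t = g j t.
Proof.
move=> hj hb; rewrite /blockwise (bigD1 (Ordinal hj))//= indicE mem_set// mul1r.
rewrite big1 ?addr0// => i hi; rewrite indicE memNset ?mul0r// => hbi.
have t0 := block_ge0 hb; move/(blockP _ t0): hb => ej; move/(blockP _ t0): hbi => ei.
by move: hi; rewrite -val_eqE /= ei -ej eqxx.
Qed.

Lemma blockwise0 g t : (forall j, (j < M)%N -> ~ block j t) -> blockwise g t = 0.
Proof. by move=> h; rewrite /blockwise big1// => i _; rewrite indicE memNset ?mul0r//; exact: h. Qed.

Lemma measurable_blockwise g : (forall j, continuous (g j)) ->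
  measurable_fun [set: R] (blockwise g).
Proof.
move=> cg; apply: measurable_sum => j; apply: measurable_funM.
  by apply: measurable_indic; exact: measurable_itv.
exact: continuous_measurable_fun.
Qed.

End Blocks.

(* [v ^+ 2 >= 2 * Y * v - Y ^+ 2] makes the average over [Om] linear in [v]. *)
Lemma average_square_integral (Om : finType) (T : R) (M : nat) (v : Om -> nat -> R -> R)
    (Y : R) (q : Om -> R) : 0 < T -> (0 < M)%N -> 0 <= Y ->
  (forall w j, continuous (v w j)) ->
  (forall t j, (j < M)%N -> block T M j t -> #|Om|%:R * Y <= \sum_w v w j t) ->
  (forall w, (\int[mu]_t (blockwise T M (fun j t => v w j t ^+ 2) t)%:E <= (q w)%:E)%E) ->
  #|Om|%:R * Y ^+ 2 * T <= \sum_w q w.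
Proof.
move=> T0 M0 Y0 cv hv hq.
have g0 w t : 0 <= blockwise T M (fun j t => v w j t ^+ 2) t.
  by apply: sumr_ge0 => j _; rewrite mulr_ge0 ?sqr_ge0// indicE.
pose bw w t := (blockwise T M (fun j t => v w j t ^+ 2) t)%:E.
have sumE : (\int[mu]_t (\sum_(w in Om) bw w t) = \sum_(w in Om) \int[mu]_t bw w t)%E.
  rewrite ge0_integral_sum//.
  - move=> w; apply/measurable_EFinP; apply: measurable_blockwise => j t.
    under eq_fun do rewrite expr2; apply: cvgM; exact: cv.
  - by move=> w t _; rewrite lee_fin.
suff L : (\int[mu]_(t in `[0%R, T[) (#|Om|%:R * Y ^+ 2)%:E <= \int[mu]_t (\sum_(w in Om) bw w t))%E.
  have cstE : (\int[mu]_(t in `[0%R, T[) (#|Om|%:R * Y ^+ 2)%:E = (#|Om|%:R * Y ^+ 2 * T)%:E)%E.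
    by rewrite integral_cst//= lebesgue_measure_itv/= lte_fin T0 oppr0 adde0 -EFinM.
  rewrite cstE sumE in L; rewrite -lee_fin -sumEFin.
  by apply: le_trans L _; apply: lee_sum => w _; exact: hq.
rewrite integral_mkcond; apply: le_ge0_integral => t.
  by rewrite patchE; case: ifP => // _; rewrite lee_fin mulr_ge0 ?sqr_ge0.
rewrite patchE; case: ifPn => [|_]; last by apply: sume_ge0 => w _; rewrite lee_fin.
rewrite inE /= in_itv /= => /andP[t0 tT].
have hj := block_index_lt T0 M0 t0 tT; set j := Num.truncn _ in hj.
have hb : block T M j t by apply/blockP.
rewrite /bw sumEFin lee_fin; under eq_bigr do rewrite (blockwiseE T0 M0 _ hj hb).
have := hv t j hj hb => hs.
apply: (@le_trans _ _ (\sum_w (2 * Y * v w j t - Y ^+ 2))).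
  rewrite sumrB -mulr_sumr sumr_const -[_ *+ _]mulr_natl.
  have := ler_wpM2l (mulr_ge0 (ler0n R 2) Y0) hs; lra.
by apply: ler_sum => w _; have := sqr_ge0 (v w j t - Y); lra.
Qed.

End TimeIntegral.

(** * The counterexample *)

Section Counterexample.
Local Open Scope classical_set_scope.
Context {R : realType}.
Local Notation mu := (@lebesgue_measure R).

Lemma block_offset (T : R) (K k j : nat) (t : R) : 0 < T -> (k <= K)%N -> block T (36 ^ K) j t ->
  0 <= t - (j %/ 36 ^ (K - k))%:R * (T / (36 ^ k)%:R) <= T / (36 ^ k)%:R.
Proof.
move=> T0 kK; rewrite /block /= in_itv /= => /andP[h1 h2].
set I := (j %/ _)%N; set q := (36 ^ (K - k))%N.
have q0 : (0 < q)%N by rewrite expn_gt0.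
have M0 : 0 < T / (36 ^ K)%:R by rewrite divr_gt0// ltr0n expn_gt0.
have e : T / (36 ^ k)%:R = q%:R * (T / (36 ^ K)%:R).
  rewrite /q -(subnKC kK) addKn expnD natrM.
  by field; rewrite !pnatr_eq0 -!lt0n !expn_gt0.
have i1 : (I * q)%:R <= j%:R :> R by rewrite ler_nat leq_trunc_div.
have i2 : j.+1%:R <= (I.+1 * q)%:R :> R by rewrite ler_nat ltn_ceil.
have := ler_wpM2r (ltW M0) i1; have := ler_wpM2r (ltW M0) i2.
rewrite e !natrM -[I.+1%:R]natr1; move: (T / _) h1 h2 => X; lra.
Qed.

Variables (a : R) (n : nat).
Hypotheses (a0 : 0 < a) (a2 : a <= 2) (n0 : (0 < n)%N).

(** The scales come from [scales_exist] with [cc = (8 n)^-1]; [delta_le] makes the error in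
    [wave_approx] at most [16^-1]. *)
Variables (K : nat) (T delta : R) (N : nat -> nat).
Hypotheses (T0 : 0 < T) (d0 : 0 < delta) (N0 : forall k, (0 < N k)%N).
Hypothesis N3 : forall k, (3 * N k <= N k.+1)%N.
Hypothesis T_le : forall k, T * (N k)%:R `^ a <= (8 * n%:R)^-1 * (36 ^ k)%:R.
Hypothesis T_ge : forall k, (8 * n%:R)^-1 * (36 ^ k)%:R <= 4 * T * (N k)%:R `^ a.
Hypothesis N_delta : (N 0%N)%:R^-1 <= delta.
Hypothesis T_delta : forall k, (k <= K)%N -> T * (N k)%:R `^ (a / 2) <= delta.
Hypothesis delta_le : delta * (1 + 5 * n%:R) * (4 * Num.sqrt 2 ^+ n) <= 16^-1.

Let Omega : finType := {ffun 'I_K.+1 * 'I_(36 ^ K).+1 -> bool}.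

Let nR : 0 < n%:R :> R. Proof. by rewrite ltr0n. Qed.
Let NR k : 0 < (N k)%:R :> R. Proof. by rewrite ltr0n. Qed.

(** By [boxv_sum] the coordinates of a frequency of level [k] add up to a number between [n * N k]
    and [2 * n * N k], so this displacement shifts its phase by an amount in [[1/2, 1]]. *)
Definition step (k : nat) : R := (2 * n%:R * (N k)%:R)^-1.

Lemma step_ge0 k : 0 <= step k.
Proof. by rewrite invr_ge0 !mulr_ge0 ?ltW. Qed.

Lemma step3 k : 3 * step k.+1 <= step k.
Proof.
rewrite /step -[leRHS]mul1r ler_pdivrMr ?mulr_gt0// mulrAC ler_pdivlMr ?mulr_gt0//.
have := N3 k; rewrite -(ler_nat R) natrM => h.
have := ler_wpM2l (ltW nR) h; lra.
Qed.

Lemma sum_step_le : n%:R * (\sum_(k < K) step k) <= delta.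
Proof.
have h : \sum_(k < K) step k <= (N 0%N)%:R^-1 / n%:R.
  have e : (N 0%N)%:R^-1 / n%:R = 2 * step 0.
    by rewrite /step; field; rewrite ?gt_eqF.
  rewrite e; case: K => [|K']; first by rewrite big_ord0 mulr_ge0 ?step_ge0.
  rewrite -(big_mkord xpredT step) big_ltn//.
  have := tail_sum_le K'.+1 0 step_ge0 step3; have := step_ge0 0; lra.
apply: le_trans N_delta; rewrite mulrC -ler_pdivlMr//.
Qed.

(** The path stays on the diagonal of space, so only the sum of the coordinates of a frequency
    enters the phase. *)
Definition ray (k : nat) (m : {ffun 'I_n -> 'I_(N k)}) : R := \sum_i (boxv m : 'rV[R]_n) 0 i.

(** Phase accumulated by the frequency up to the beginning of block [I]. *)
Definition start (k : nat) (m : {ffun 'I_n -> 'I_(N k)}) (I : nat) : R :=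
  I%:R * (T / (36 ^ k)%:R) * vnorm (boxv m : 'rV[R]_n) `^ a.

Definition amplitude (w : Omega) (k I : nat) : R := ((N k)%:R ^+ n)^-1 * sgn w k I.

Definition wphase (w : Omega) (k : nat) (m : {ffun 'I_n -> 'I_(N k)}) (I : nat) : R :=
  phase step w (ray m) (start m) k I.

Lemma focus_lower (k j : nat) (m : {ffun 'I_n -> 'I_(N k)}) (t : R) :
  (k < K)%N -> (j < 36 ^ K)%N -> block T (36 ^ K) j t ->
  #|Omega|%:R / 16 <= \sum_(w : Omega) \sum_(I < 36 ^ k)
     sgn w k I * wave a t (const_mx (sgn_path step w j)) (boxv m) (wphase w m I).
Proof.
move=> kK hj hb; have kK' := ltnW kK.
have /andP[s1 s2] := @boxv_sum R n (N k) n0 (N0 k) m.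
have nN : 0 < n%:R * (N k)%:R :> R by rewrite mulr_gt0.
have sg0 : 0 <= ray m by apply: le_trans s1; exact: ltW.
have t0 : 0 <= t.
  move: hb; rewrite /block /= in_itv /= => /andP[h _]; apply: le_trans h.
  by rewrite mulr_ge0// divr_ge0// ltW.
have tT : t <= T.
  move: hb; rewrite /block /= in_itv /= => /andP[_ /ltW h]; apply: (le_trans h).
  rewrite mulrCA ler_piMr ?(ltW T0)// ler_pdivrMr ?ltr0n ?expn_gt0// mul1r ler_nat//.
have P36 : 0 < (36 ^ k)%:R :> R by rewrite ltr0n expn_gt0.
have -> : #|Omega|%:R / 16 = #|Omega|%:R * (8^-1 - 16^-1) :> R by field.
apply: (@sum_focus R 36 K isT step step_ge0
  (fun y c => wave a t (const_mx y) (boxv m) c) (ray m) (t * vnorm (boxv m : 'rV[R]_n) `^ a)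
  (start m) 16^-1 k j kK hj).
- rewrite /step ler_pdivlMr ?mulr_gt0// ler_pdivrMr ?mulr_gt0// mul1r.
  by rewrite /ray in s1 s2 *; apply/andP; split; lra.
(* Within one block the time phase drifts by at most [(T / 36 ^ k) * 4 n (N k) ^ a], and the
   constant [(8 n)^-1] in [T_le] makes this at most 1/2. *)
- rewrite /start -mulrBl normrM (ger0_norm (powR_ge0 _ _)).
  have /andP[t1 t2] := block_offset T0 kK' hb; rewrite (ger0_norm t1).
  apply: (@le_trans _ _ (T / (36 ^ k)%:R * (4 * n%:R * (N k)%:R `^ a))).
    by apply: ler_pM => //; [exact: powR_ge0|exact: boxv_vnorm_powR].
  have h := T_le k.
  have -> : T / (36 ^ k)%:R * (4 * n%:R * (N k)%:R `^ a) =
     4 * n%:R * (T * (N k)%:R `^ a / (36 ^ k)%:R) by field; rewrite gt_eqF.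
  apply: (@le_trans _ _ (4 * n%:R * (8 * n%:R)^-1)); last first.
    by rewrite le_eqVlt; apply/orP; left; apply/eqP; field; rewrite gt_eqF.
  by rewrite ler_wpM2l ?mulr_ge0 ?(ltW nR)// ler_pdivrMr.
(* The finer levels move the path by at most [step k / 2], while [ray m] is at most the inverse of
   [step k]. *)
- rewrite ger0_norm//.
  apply: (@le_trans _ _ (2 * n%:R * (N k)%:R * (step k / 2))).
    apply: ler_pM => //; last exact: tail_sum_le step_ge0 step3.
    by apply: sumr_ge0 => i _; exact: step_ge0.
  rewrite /step le_eqVlt; apply/orP; left; apply/eqP; field.
  by rewrite !gt_eqF.
- move=> y c hy.
  have -> : ray m * y = vdot (const_mx y) (boxv m).
    by rewrite /vdot /ray mulr_suml; apply: eq_bigr => i _; rewrite [const_mx _ _ _]mxE mulrC.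
  apply: le_trans delta_le; apply: wave_approx => //.
    by rewrite mulr_ge0 ?addr_ge0 ?mulr_ge0 ?(ltW d0) ?(ltW nR).
  move=> eta; apply: boxv_phase => //.
    by apply: le_trans (T_delta kK'); rewrite ler_wpM2r ?powR_ge0.
  by apply: le_trans sum_step_le; rewrite ler_wpM2l ?(ltW nR).
Qed.

(** Cubes and numbers of blocks depend on the level, hence the dependent pairs. [Wave] indexes the
    packets; [Freq] groups those of the same frequency. *)
Let Wave : finType := {k : 'I_K & ({ffun 'I_n -> 'I_(N k)} * 'I_(36 ^ k))%type}.
Let Freq : finType := {k : 'I_K & {ffun 'I_n -> 'I_(N k)}}.

Lemma sum_Freq (F : forall k : nat, {ffun 'I_n -> 'I_(N k)} -> R) :
  \sum_(p : Freq) F (tag p) (tagged p) = \sum_(k < K) \sum_m F k m.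
Proof. by rewrite sig_big_dep. Qed.

Lemma sum_Wave (F : forall k : nat, {ffun 'I_n -> 'I_(N k)} -> nat -> R) :
  \sum_(p : Wave) F (tag p) (tagged p).1 (tagged p).2 =
  \sum_(p : Freq) \sum_(I < 36 ^ tag p) F (tag p) (tagged p) I.
Proof.
rewrite (sum_Freq (fun k m => \sum_(I < 36 ^ k) F k m I)).
transitivity (\sum_(k < K) \sum_(q : {ffun 'I_n -> 'I_(N k)} * 'I_(36 ^ k)) F k q.1 q.2).
  by rewrite sig_big_dep.
by apply: eq_bigr => k _; rewrite pair_big.
Qed.

(** A cube of level [k] has [N k ^ n] points, so each level has total weight 1. *)
Lemma sum_Freq_mean (X : R) :
  \sum_(p : Freq) ((N (tag p))%:R ^+ n)^-1 * X = K%:R * X.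
Proof.
rewrite (sum_Freq (fun k m => ((N k)%:R ^+ n)^-1 * X)).
transitivity (\sum_(k < K) X); last by rewrite sumr_const card_ord -[LHS]mulr_natl.
apply: eq_bigr => k _; rewrite sumr_const -[LHS]mulr_natl card_ffun !card_ord natrX.
by rewrite mulrA divff ?mul1r// gt_eqF ?exprn_gt0.
Qed.

Definition datum (w : Omega) : 'rV[R]_n -> R[i] :=
  packet (index_enum Wave)
    (fun p => amplitude w (tag p) (tagged p).2)
    (fun p => wphase w (tagged p).1 (tagged p).2)
    (fun p => boxv (tagged p).1).

Lemma Re_prop_op_datum w t x :
  complex.Re (prop_op a t (datum w) x) =
  \sum_(p : Freq) \sum_(I < 36 ^ tag p)
     amplitude w (tag p) I * wave a t x (boxv (tagged p)) (wphase w (tagged p) I).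
Proof.
rewrite Re_prop_op_packet//.
exact: (sum_Wave (fun k m I => amplitude w k I * wave a t x (boxv m) (wphase w m I))).
Qed.

Lemma datum_lower (j : nat) (t : R) : (j < 36 ^ K)%N -> block T (36 ^ K) j t ->
  #|Omega|%:R * (K%:R / 16) <=
  \sum_w complex.Re (prop_op a t (datum w) (const_mx (sgn_path step w j))).
Proof.
move=> hj hb; under eq_bigr do rewrite Re_prop_op_datum.
rewrite exchange_big /=.
apply: (@le_trans _ _ (\sum_(p : Freq) ((N (tag p))%:R ^+ n)^-1 * (#|Omega|%:R / 16))).
  by rewrite sum_Freq_mean mulrCA.
apply: ler_sum => p _.
have := focus_lower (tagged p) (ltn_ord (tag p)) hj hb.
rewrite -(ler_pM2l (_ : 0 < ((N (tag p))%:R ^+ n)^-1)) ?invr_gt0 ?exprn_gt0// => h.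
apply: le_trans h _; rewrite mulr_sumr ler_sum// => w _.
by rewrite mulr_sumr ler_sum// => I _; rewrite /amplitude mulrA.
Qed.

(** The blocks are summed first: each frequency then occurs once, as the overlap bound [lattice_sum]
    requires. *)
Lemma fourier_datum w xi : fourier (datum w) xi =
  Complex (\sum_(p : Freq) (Num.sqrt (2 * pi) ^+ n * ((N (tag p))%:R ^+ n)^-1 *
              \sum_(I < 36 ^ tag p) sgn w (tag p) I * cos (wphase w (tagged p) I)) *
              expR (- sqn (xi - boxv (tagged p)) / 2))
          (\sum_(p : Freq) (Num.sqrt (2 * pi) ^+ n * ((N (tag p))%:R ^+ n)^-1 *
              \sum_(I < 36 ^ tag p) sgn w (tag p) I * sin (wphase w (tagged p) I)) *
              expR (- sqn (xi - boxv (tagged p)) / 2)).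
Proof.
rewrite fourier_packet; congr Complex.
- rewrite (sum_Wave (fun k m I => amplitude w k I *
    (Num.sqrt (2 * pi) ^+ n * expR (- sqn (xi - boxv m) / 2) * cos (wphase w m I)))).
  apply: eq_bigr => p _; rewrite mulr_sumr mulr_suml; apply: eq_bigr => I _.
  by rewrite /amplitude; ring.
- rewrite (sum_Wave (fun k m I => amplitude w k I *
    (Num.sqrt (2 * pi) ^+ n * expR (- sqn (xi - boxv m) / 2) * sin (wphase w m I)))).
  apply: eq_bigr => p _; rewrite mulr_sumr mulr_suml; apply: eq_bigr => I _.
  by rewrite /amplitude; ring.
Qed.

(** On average a frequency of level [k] contributes at most a constant times
    [36 ^ k * N k ^ (2 s - 2 n)], by orthogonality of the signs. With [2 s = n - a] and [T_ge] this
    is at most a constant times [T * N k ^ (- n)], and the cube has [N k ^ n] points. *)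
Lemma datum_sobolev (s : R) : 0 <= s -> s <= n%:R -> 2 * s = n%:R - a ->
  \sum_(p : Freq) (\sum_(w : Omega)
    ((Num.sqrt (2 * pi) ^+ n * ((N (tag p))%:R ^+ n)^-1 *
         \sum_(I < 36 ^ tag p) sgn w (tag p) I * cos (wphase w (tagged p) I)) ^+ 2 +
     (Num.sqrt (2 * pi) ^+ n * ((N (tag p))%:R ^+ n)^-1 *
         \sum_(I < 36 ^ tag p) sgn w (tag p) I * sin (wphase w (tagged p) I)) ^+ 2)) *
    (1 + sqn (boxv (tagged p) : 'rV[R]_n)) `^ s <=
  #|Omega|%:R * T * K%:R * ((2 * pi) ^+ n * (5 * n%:R) ^+ n * (32 * n%:R)).
Proof.
move=> s0 sn sa.
have pi2 : 0 <= 2 * pi :> R by rewrite mulr_ge0 ?pi_ge0.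
have Nn k : 0 < (N k)%:R ^+ n :> R by rewrite exprn_gt0.
have Na k : 0 < (N k)%:R `^ a :> R by rewrite powR_gt0.
apply: (@le_trans _ _ (\sum_(p : Freq) ((N (tag p))%:R ^+ n)^-1 *
   (#|Omega|%:R * T * ((2 * pi) ^+ n * (5 * n%:R) ^+ n * (32 * n%:R))))); last first.
  by rewrite sum_Freq_mean le_eqVlt; apply/orP; left; apply/eqP; ring.
apply: ler_sum => p _; set k : nat := tag p; set m := tagged p.
have -> : \sum_(w : Omega)
    ((Num.sqrt (2 * pi) ^+ n * ((N k)%:R ^+ n)^-1 *
         \sum_(I < 36 ^ k) sgn w k I * cos (wphase w m I)) ^+ 2 +
     (Num.sqrt (2 * pi) ^+ n * ((N k)%:R ^+ n)^-1 *
         \sum_(I < 36 ^ k) sgn w k I * sin (wphase w m I)) ^+ 2) =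
   (2 * pi) ^+ n * (((N k)%:R ^+ n)^-1) ^+ 2 * (#|Omega|%:R * (36 ^ k)%:R).
  rewrite -(@sum_phase_sqr R 36 K isT step (ray m) (start m) k (ltnW (ltn_ord (tag p)))).
  have sq : Num.sqrt (2 * pi) ^+ n ^+ 2 = (2 * pi) ^+ n :> R by rewrite exprAC sqr_sqrtr.
  by rewrite mulr_sumr; apply: eq_bigr => w _; rewrite -sq /wphase; ring.
have wt := boxv_weight n0 (N0 k) m s0 sn.
have NE : (N k)%:R `^ (2 * s) = (N k)%:R ^+ n / (N k)%:R `^ a :> R.
  by rewrite sa powRB ?powR_mulrn ?ler0n//; apply/implyP => _; rewrite gt_eqF.
rewrite NE in wt.
have c0 : 0 <= (2 * pi) ^+ n * (((N k)%:R ^+ n)^-1) ^+ 2 * (#|Omega|%:R * (36 ^ k)%:R) :> R.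
  by rewrite !mulr_ge0 ?exprn_ge0 ?invr_ge0 ?exprn_ge0 ?ler0n.
apply: (le_trans (ler_wpM2l c0 wt)).
have h36 : (36 ^ k)%:R <= 32 * n%:R * T * (N k)%:R `^ a.
  have h := ler_wpM2l (mulr_ge0 (ler0n R 8) (ltW nR)) (T_ge k).
  rewrite mulrA divff ?mul1r in h; last by rewrite mulf_neq0 ?gt_eqF.
  by apply: (le_trans h); rewrite le_eqVlt; apply/orP; left; apply/eqP; ring.
have b0 : 0 <= (2 * pi) ^+ n * ((N k)%:R ^+ n)^-1 * #|Omega|%:R * (5 * n%:R) ^+ n / (N k)%:R `^ a :> R.
  by rewrite !(mulr_ge0, exprn_ge0, invr_ge0, powR_ge0, ler0n, pi_ge0).
apply: (le_trans (le_trans _ (ler_wpM2l b0 h36)));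
  rewrite le_eqVlt; apply/orP; left; apply/eqP; field; rewrite ?gt_eqF//.
Qed.

(** The averaged lower and upper bounds are combined. The conclusion of [Hnorm_le] is taken as a
    hypothesis so that [C1] can be fixed before [K] and [T]. *)
Lemma scales_bounded (C C1 s : R) : 0 <= s -> s <= n%:R -> 2 * s = n%:R - a ->
  0 < C1 ->
  (forall (P : Type) (ps : seq P) (A B : P -> R) (l : P -> 'rV[R]_n)
      (f : 'rV[R]_n -> R[i]) (G : R),
   (forall xi, fourier f xi =
      Complex (\sum_(p <- ps) A p * expR (- sqn (xi - l p) / 2))
              (\sum_(p <- ps) B p * expR (- sqn (xi - l p) / 2))) ->
   0 < G -> (forall xi, \sum_(p <- ps) expR (- sqn (xi - l p) / 2) <= G) ->
   exists Q, [/\ 0 <= Q, Hnorm s f = (Num.sqrt Q)%:E &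
     Q <= C1 * G * \sum_(p <- ps) (A p ^+ 2 + B p ^+ 2) * (1 + sqn (l p)) `^ s]) ->
  (forall f : 'rV[R]_n -> R[i], schwartz f -> (L2tLinfx a f <= C%:E * Hnorm s f)%E) ->
  #|Omega|%:R * (K%:R / 16) ^+ 2 * T <=
  C ^+ 2 * (C1 * 8 ^+ n * (#|Omega|%:R * T * K%:R *
    ((2 * pi) ^+ n * (5 * n%:R) ^+ n * (32 * n%:R)))).
Proof.
move=> s0 sn s2 C10 hH hC.
have N2 k : (2 * N k <= N k.+1)%N by apply: leq_trans (N3 k); rewrite leq_mul2r orbT.
have hG xi : \sum_(p : Freq) expR (- sqn (xi - boxv (tagged p)) / 2) <= 8 ^+ n :> R.
  rewrite (sum_Freq (fun k m => expR (- sqn (xi - boxv m) / 2))).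
  by move: (n) n0 xi => [//|n'] _ xi; exact: lattice_sum.
have G0 : 0 < 8 ^+ n :> R by rewrite exprn_gt0.
have [Q hQ] := choice (fun w => hH _ _ _ _ _ _ _ (fourier_datum w) G0 hG).
have M0 : (0 < 36 ^ K)%N by rewrite expn_gt0.
have Y0 : 0 <= K%:R / 16 :> R by rewrite divr_ge0.
apply: (@le_trans _ _ (\sum_(w : Omega) C ^+ 2 * Q w)).
  apply: (@average_square_integral R Omega T (36 ^ K)
    (fun w j t => complex.Re (prop_op a t (datum w) (const_mx (sgn_path step w j)))) _ _ T0 M0 Y0).
  - move=> w j t; under eq_fun do rewrite Re_prop_op_packet//.
    apply: cvg_big => [|p _]; first exact: add_continuous.
    by apply: cvgMr; exact: continuous_wave.
  - by move=> t j hj hb; exact: datum_lower.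
  - move=> w; have [Q0 hQE _] := hQ w.
    have -> : C ^+ 2 * Q w = (C * Num.sqrt (Q w)) ^+ 2 by rewrite exprMn sqr_sqrtr.
    apply: (@integral_le_of_L2tLinfx R a n (datum w)).
    + by move=> t; apply: sumr_ge0 => j _; rewrite mulr_ge0 ?sqr_ge0// indicE.
    (* In a block the point is taken on the path, where the real part bounds the modulus from below;
       outside all blocks the lower bound is 0 and any point serves. *)
    + move=> t; case: (pselect (exists2 j, (j < 36 ^ K)%N & block T (36 ^ K) j t)) => [[j hj hb]|h].
        exists (const_mx (sgn_path step w j)); rewrite (blockwiseE T0 M0 _ hj hb).
        by rewrite /cabs sqr_sqrtr ?addr_ge0 ?sqr_ge0// lerDl sqr_ge0.
      exists 0; rewrite blockwise0 ?sqr_ge0// => j hj hb.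
      by apply: h; exists j.
    + by rewrite EFinM -hQE; apply: hC; exact: packet_schwartz.
rewrite -mulr_sumr ler_wpM2l ?sqr_ge0//.
have hQ3 w := let: And3 _ _ h := hQ w in h.
apply: le_trans (ler_sum _ (fun w _ => hQ3 w)) _.
rewrite -mulr_sumr ler_pM2l ?mulr_gt0//.
rewrite exchange_big /=; apply: le_trans (datum_sobolev s0 sn s2).
by rewrite le_eqVlt; apply/orP; left; apply/eqP; apply: eq_bigr => p _; rewrite mulr_suml.
Qed.

End Counterexample.

Theorem theorem1p1 (R : realType) (a : R) (d : nat) :
  0 < a -> a <= 2 -> (d_a a < d)%N ->
  ~ (exists C : R, forall f : 'rV[R]_d -> R[i], schwartz f ->
        (L2tLinfx a f <= C%:E * Hnorm ((d%:R - a) / 2) f)%E).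
Proof.
move=> a0 a2 hd [C hC].
have d2 : (2 < d)%N by apply: leq_trans hd; rewrite /d_a; case: ifP.
case: d hd hC d2 => [//|n'] _ hC d2; set n := n'.+1 in hC d2 *.
have n0 : (0 < n)%N by [].
have nR : 3 <= n%:R :> R by rewrite ler_nat.
pose s := (n%:R - a) / 2.
have s0 : 0 <= s by rewrite divr_ge0// subr_ge0; lra.
have sn : s <= n%:R by rewrite /s ler_pdivrMr//; lra.
have s2 : 2 * s = n%:R - a by rewrite /s mulrC divfK.
have [C1 C10 hH] := Hnorm_le s0 sn.
(* With this value the error allowed by [wave_approx] is exactly [16^-1]. *)
pose delta : R := (64 * Num.sqrt 2 ^+ n * (1 + 5 * n%:R))^-1.
have q0 : 0 < Num.sqrt 2 ^+ n :> R by rewrite exprn_gt0// sqrtr_gt0.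
have n5 : 0 < 1 + 5 * n%:R :> R by lra.
have dl0 : 0 < delta by rewrite invr_gt0 !mulr_gt0.
have hdelta : delta * (1 + 5 * n%:R) * (4 * Num.sqrt 2 ^+ n) <= 16^-1.
  by rewrite /delta le_eqVlt; apply/orP; left; apply/eqP; field; rewrite !gt_eqF.
have cc0 : 0 < (8 * n%:R)^-1 :> R by rewrite invr_gt0 mulr_gt0//; lra.
pose X : R := (2 * pi) ^+ n * (5 * n%:R) ^+ n * (32 * n%:R).
pose B := C ^+ 2 * (C1 * 8 ^+ n * X).
(* Cancelling the number of sign choices, [T] and [K] in [scales_bounded] leaves [K / 256 <= B],
   with [256 = 16 ^ 2]; this [K] violates it. *)
pose K := (Num.truncn (256 * B)).+1.
have hK : 256 * B < K%:R by exact: truncnS_gt.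
have K0 : 0 < K%:R :> R by rewrite ltr0n.
have [T [N [T0 N0 N3 hT1 [hT2 hN hT3]]]] := scales_exist K a0 a2 cc0 dl0.
pose Om : finType := {ffun 'I_K.+1 * 'I_(36 ^ K).+1 -> bool}.
have Om0 : 0 < #|Om|%:R :> R by rewrite card_ffun card_bool natrX exprn_gt0.
have := scales_bounded a0 a2 n0 T0 dl0 N0 N3 hT1 hT2 hN hT3 hdelta s0 sn s2 C10 hH hC.
rewrite -/Om -/X.
have -> : C ^+ 2 * (C1 * 8 ^+ n * (#|Om|%:R * T * K%:R * X)) = #|Om|%:R * T * (K%:R * B).
  by rewrite /B; ring.
have -> : #|Om|%:R * (K%:R / 16) ^+ 2 * T = #|Om|%:R * T * (K%:R * (K%:R / 256)) by field.
by rewrite !ler_pM2l ?mulr_gt0// ler_pdivrMr// leNgt mulrC hK.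
Qed.
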